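(* Let $\{(y^t,x^t,u^t,z^t)\}$ be a sequence generated by the STAM algorithm (described in the context) for the problem $\min_{x,y} F(x)+G(y)+H(x,y)$. Suppose that the stochastic gradient $\tilde\nabla G$ satisfies the Expected Smoothness assumption and that $G,H$ satisfy the smoothness assumptions (a1)–(a3), all stated in the context. Define $$\mathcal K_1:=\frac{1-(10(l+L_2^* )+4)\gamma-5(L_2^* )^2\gamma^2}{4\gamma},\qquad \mathcal K_2:=\frac{5(1+\gamma L_2^* )^2}{4\gamma^2},$$ $$\mathcal K_3:=L_4^*(1+5\gamma L_4^* )+\frac{5\mathcal K_1(L_4^* )^2}{\mathcal K_2},\qquad M:=2\mathcal K_3 .$$ Suppose that the parameters $\gamma,\beta>0$ are chosen such that $\mathcal K_1>0$, $\left[(L_2^* )^2+(L_5^* )^2\right]\gamma^2\le 1$ and $\beta\mathcal K_1/\mathcal K_2\ge 2$ hold. Then $$\min_{0\le t\le T-1}\Big[\mathbb E\|\nabla G(y^t)+\nabla_yH(u^t,y^t)\|^2+\mathbb E\,\mathrm{dist}^2\big(0,\nabla_xH(u^t,y^t)+\partial F(u^t)\big)\Big]\le 2\,\frac{\left(1+\frac{(L+M)A}{\beta^2}\right)^T}{T}\,\beta\,(\delta_0+\mathcal M_0')+\frac{(L+M)C}{\beta}.$$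
   Context: Functions. $F,G,H$ are proper lower semicontinuous functions, not necessarily convex; $F$ and $G$ are functions of $x\in\mathbb R^n$ and $y\in\mathbb R^n$ respectively, $H$ is a function of $(x,y)$, and $G,H$ have the gradients appearing below. $\partial F$ is the (limiting) subdifferential, and $\mathrm{dist}(0,S)=\inf_{s\in S}\|s\|$. Write $G^{\inf}=\inf_yG(y)$, $H^{\inf}=\inf_{x,y}H(x,y)$, $(G+H)^{\inf}=\inf_{x,y}(G(y)+H(x,y))$. Smoothness assumptions. (a1) $G$ is bounded from below and $\nabla G$ is Lipschitz continuous with constant $L_1>0$. (a2) There exist $L_2(y),L_3(x),L_4(x),L_5(y)>0$ such that for all arguments in $\mathbb R^n$ $\|\nabla_xH(x_1,y)-\nabla_xH(x_2,y)\|\le L_2(y)\|x_1-x_2\|$, $\|\nabla_xH(x,y_1)-\nabla_xH(x,y_2)\|\le L_4(x)\|y_1-y_2\|$, $\|\nabla_yH(x,y_1)-\nabla_yH(x,y_2)\|\le L_3(x)\|y_1-y_2\|$, $\|\nabla_yH(x_1,y)-\nabla_yH(x_2,y)\|\le L_5(y)\|x_1-x_2\|$. (a3) There exist $L_2^*,L_3^*,L_4^*,L_5^*\ge 0$ and $L>0$ with $\sup_yL_2(y)\le L_2^*$, $\sup_xL_3(x)\le L_3^*$, $\sup_xL_4(x)\le L_4^*$, $\sup_yL_5(y)\le L_5^*$ and $L_3^*+L_1\le L$. In addition, $l\in\mathbb R$ is such that $H(\cdot,y)+\frac l2\|\cdot\|^2$ is convex for all $y\in\mathbb R^n$ (such $l$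 always exists, e.g. $l=L_2^*$). Stochastic gradient. The gradient estimator $\tilde\nabla G(y)$ is unbiased, $\mathbb E[\tilde\nabla G(y)]=\nabla G(y)$. Expected Smoothness: for some $A_0,B_0,C_0\ge0$, $\mathbb E[\|\tilde\nabla G(y)\|^2]\le 2A_0(G(y)-G^{\inf})+B_0\|\nabla G(y)\|^2+C_0$ for all $y\in\mathbb R^n$. STAM algorithm. Choose parameters $\gamma,\beta>0$ and an initial point $x^0,y^0$ (the other starting values are not specified further). For $t=0,\dots,T-1$: $y^{t+1}\in\arg\min_y\{\langle\tilde\nabla G(y^t)+\nabla_yH(x^t,y^t),y-y^t\rangle+\frac\beta2\|y-y^t\|^2\}$, $x^{t+1}\in\arg\min_x\{H(x,y^{t+1})+\frac1{2\gamma}\|x-z^t\|^2\}$, $u^{t+1}\in\arg\min_u\{F(u)+\frac1{2\gamma}\|2x^{t+1}-z^t-u\|^2\}$, $z^{t+1}=z^t+(u^{t+1}-x^{t+1})$. Constants. $A=\max(2A_0+2B_0L_1,\,2L_3^* )$, $C=2A[(G+H)^{\inf}-G^{\inf}-H^{\inf}]+2C_0$; $\delta_t=\mathbb E[G(y^t)+H(x^t,y^t)-(G+H)^{\inf}]$; $\mathcal M_0'=\mathbb E[\mathcal M_0-\inf_{t\ge0}\mathcal M_t]$, where $\mathcal M_t=F(u^t)+\frac1{2\gamma}\|2x^t-u^t-z^t\|^2-\frac1{2\gamma}\|x^t-z^t\|^2-\frac1\gamma\|u^t-x^t\|^2$.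
   Formalization: The starting values u^0, z^0, left unspecified, are required to arise with x^0 from the x-, u- and z-updates applied to some z^{-1} (x^0, y^0 stay free); for arbitrary u^0 the bound fails, e.g. F=G=0, H=ax²/2, x^0=y^0=z^0=0, u^0≠0, T=1. *)

(* Defs.v *)
From HB Require Import structures.
From mathcomp Require Import all_boot all_order all_algebra.
From mathcomp Require Import all_classical all_reals all_analysis.

Set Implicit Arguments.
Unset Strict Implicit.
Unset Printing Implicit Defensive.

Import Order.TTheory GRing.Theory Num.Theory.
Import numFieldNormedType.Exports.

Local Open Scope classical_set_scope.
Local Open Scope ring_scope.

Definition dot (R : realType) (n : nat) (u v : 'rV[R]_n) : R :=
  \sum_(i < n) u ord0 i * v ord0 i.

(* The library norm on 'rV[R]_n is the max norm: it gives the same topology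
   and the same derivatives, but not the same Lipschitz constants. *)
Definition enorm (R : realType) (n : nat) (u : 'rV[R]_n) : R :=
  Num.sqrt (dot u u).

(* Only meaningful where f is differentiable, which is always assumed apart. *)
Definition grad (R : realType) (n : nat) (f : 'rV[R]_n -> R) (x : 'rV[R]_n) :
    'rV[R]_n :=
  \row_(i < n) 'D_(delta_mx ord0 i) f x.

Definition gradx (R : realType) (n : nat) (H : 'rV[R]_n -> 'rV[R]_n -> R)
    (x y : 'rV[R]_n) : 'rV[R]_n :=
  grad (fun x' => H x' y) x.

Definition grady (R : realType) (n : nat) (H : 'rV[R]_n -> 'rV[R]_n -> R)
    (x y : 'rV[R]_n) : 'rV[R]_n :=
  grad (fun y' => H x y') y.

Definition proper_function (R : realType) (n : nat) (F : 'rV[R]_n -> \bar R) : Prop :=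
  (forall x, F x != -oo%E) /\ (exists x, F x != +oo%E).

(* F u >= F x + <v, u - x> + o(|u - x|) as u --> x, at a point of finiteness. *)
Definition regular_subgradient (R : realType) (n : nat)
    (F : 'rV[R]_n -> \bar R) (x v : 'rV[R]_n) : Prop :=
  F x \is a fin_num /\
  forall e : R, 0 < e ->
    \forall u \near x,
      (F x + (dot v (u - x) - e * enorm (u - x))%:E <= F u)%E.

(* Limiting (Mordukhovich) subdifferential; empty outside the domain of F. *)
Definition limiting_subdiff (R : realType) (n : nat)
    (F : 'rV[R]_n -> \bar R) (x : 'rV[R]_n) : set 'rV[R]_n :=
  [set v | F x \is a fin_num /\
    exists xk vk : nat -> 'rV[R]_n,
      [/\ xk k @[k --> \oo] --> x,
          F (xk k) @[k --> \oo] --> F x,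
          forall k, regular_subgradient F (xk k) (vk k) &
          vk k @[k --> \oo] --> v]].

(* +oo when S is empty. *)
Definition dist0 (R : realType) (n : nat) (S : set 'rV[R]_n) : \bar R :=
  ereal_inf [set (enorm s)%:E | s in S].

Definition argmin (R : realType) (X : Type) (f : X -> \bar R) : set X :=
  [set x | forall x', (f x <= f x')%E].

(* R^n with its Borel sigma-algebra. *)
Definition borelRn (R : realType) (n : nat) :=
  g_sigma_algebraType (@open 'rV[R]_n).

(* D is the law of the sample s in the estimator g y s of the gradient of G
   at y. Measurability and expected smoothness make each coordinate of g y
   integrable, so that the equations of unbiasedness are between genuine
   expectations. *)
Definition unbiased (R : realType) (n : nat) (dS : measure_display)
    (S : measurableType dS) (D : probability S R) (G : 'rV[R]_n -> R)
    (g : 'rV[R]_n -> S -> 'rV[R]_n) : Prop :=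
  forall (y : 'rV[R]_n) (i : 'I_n),
    (\int[D]_s (g y s ord0 i)%:E = (grad G y ord0 i)%:E)%E.

Definition expected_smoothness (R : realType) (n : nat) (dS : measure_display)
    (S : measurableType dS) (D : probability S R) (G : 'rV[R]_n -> R)
    (g : 'rV[R]_n -> S -> 'rV[R]_n) (A0 B0 C0 : R) : Prop :=
  forall y : 'rV[R]_n,
    (\int[D]_s (enorm (g y s) ^+ 2)%:E <=
     (2 * A0 * (G y - inf (range G)) + B0 * enorm (grad G y) ^+ 2 + C0)%:E)%E.

Section stam.
Context (R : realType) (n : nat).
Implicit Types (F : 'rV[R]_n -> \bar R) (H : 'rV[R]_n -> 'rV[R]_n -> R).

(* v is the value of the stochastic gradient of G at y. *)
Definition y_update H (beta : R) (x y v : 'rV[R]_n) : set 'rV[R]_n :=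
  argmin (fun y' => (dot (v + grady H x y) (y' - y)
                     + beta / 2 * enorm (y' - y) ^+ 2)%:E).

Definition x_update H (gamma : R) (y z : 'rV[R]_n) : set 'rV[R]_n :=
  argmin (fun x' => (H x' y + 1 / (2 * gamma) * enorm (x' - z) ^+ 2)%:E).

Definition u_update F (gamma : R) (x z : 'rV[R]_n) : set 'rV[R]_n :=
  argmin (fun u' =>
    (F u' + (1 / (2 * gamma) * enorm (2 *: x - z - u') ^+ 2)%:E)%E).

Definition merit F (gamma : R) (x u z : 'rV[R]_n) : \bar R :=
  (F u + (1 / (2 * gamma) * enorm (2 *: x - u - z) ^+ 2
          - 1 / (2 * gamma) * enorm (x - z) ^+ 2
          - 1 / gamma * enorm (u - x) ^+ 2)%:E)%E.

(* The starting point (x0, y0) is free, while u0 and z0 come, together with x0,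
   from the x-, u- and z-updates applied to some z(-1). As soon as
   H(., y0) + |.|^2 / (2 gamma) is convex, z(-1) = x0 + gamma gradx H x0 y0
   does for x0, so that the first condition does not restrict (x0, y0). *)
Definition stam_start F H (gamma : R) (y0 x0 u0 z0 : 'rV[R]_n) : Prop :=
  exists zm1 : 'rV[R]_n,
    [/\ x_update H gamma y0 zm1 x0,
        u_update F gamma x0 zm1 u0 &
        z0 = zm1 + (u0 - x0)].

Context (d dS : measure_display) (Omega : measurableType d)
  (P : probability Omega R) (S : measurableType dS) (D : probability S R).
Implicit Types (y x u z : nat -> Omega -> 'rV[R]_n).

Definition generated_by (X : nat -> Omega -> 'rV[R]_n) (t : nat) :
    set (set Omega) :=
  [set E | exists s (B : set (borelRn R n)),
             [/\ (s <= t)%N, measurable B & E = X s @^-1` B]].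

(* The sigma-algebra generated by all the iterates up to time t. *)
Definition history y x u z (t : nat) : set (set Omega) :=
  <<s generated_by y t `|` generated_by x t
      `|` generated_by u t `|` generated_by z t >>.

(* Iterations t = 0, ..., T-1. Iteration t evaluates the estimator g at y t on
   a sample xi t of law D that is independent of the iterates up to time t. *)
Record stam_run F H (g : 'rV[R]_n -> S -> 'rV[R]_n) (gamma beta : R) (T : nat)
    (xi : nat -> Omega -> S) y x u z : Prop := StamRun {
  stam_measurable : forall t,
    [/\ measurable_fun setT (y t : Omega -> borelRn R n),
        measurable_fun setT (x t : Omega -> borelRn R n),
        measurable_fun setT (u t : Omega -> borelRn R n) &
        measurable_fun setT (z t : Omega -> borelRn R n)] ;
  stam_init : forall w, stam_start F H gamma (y 0 w) (x 0 w) (u 0 w) (z 0 w) ;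
  stam_sample : forall t, (t < T)%N -> measurable_fun setT (xi t) ;
  stam_law : forall t (B : set S), (t < T)%N -> measurable B ->
    P (xi t @^-1` B) = D B ;
  stam_fresh : forall t (E : set Omega) (B : set S), (t < T)%N ->
    history y x u z t E -> measurable B ->
    P (E `&` xi t @^-1` B) = (P E * P (xi t @^-1` B))%E ;
  stam_y : forall t w, (t < T)%N ->
    y_update H beta (x t w) (y t w) (g (y t w) (xi t w)) (y t.+1 w) ;
  stam_x : forall t w, (t < T)%N ->
    x_update H gamma (y t.+1 w) (z t w) (x t.+1 w) ;
  stam_u : forall t w, (t < T)%N ->
    u_update F gamma (x t.+1 w) (z t w) (u t.+1 w) ;
  stam_z : forall t w, (t < T)%N ->
    z t.+1 w = z t w + (u t.+1 w - x t.+1 w)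
}.

End stam.

(* Main.v *)
Require Import Defs.
From HB Require Import structures.
From mathcomp Require Import all_boot all_order all_algebra.
From mathcomp Require Import all_classical all_reals all_analysis.
From mathcomp Require Import measurable_realfun ring lra.

Set Implicit Arguments.
Unset Strict Implicit.
Unset Printing Implicit Defensive.

Import Order.TTheory GRing.Theory Num.Theory.
Import numFieldNormedType.Exports.

Local Open Scope classical_set_scope.
Local Open Scope ring_scope.

(* Let Phi_t = G(y_t) + H(x_t, y_t) - inf (G + H) and N_t = M_t - inf_s M_s, both
   nonnegative. The optimality conditions of the x- and z-updates give
   u_t - x_{t+1} = gamma (grad_x H(x_{t+1}, y_{t+1}) - grad_x H(x_t, y_t)), so the
   x-, u- and z-steps decrease H(., y_{t+1}) + M by a multiple of |u_t - x_t|^2 up to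
   an error K3 |y_{t+1} - y_t|^2. Adding the descent inequality of the y-step yields,
   at every sample point,
     Phi_{t+1} + N_{t+1} + e_t <= Psi(x_t, y_t, g(y_t, xi_t)) + N_t,
   where 2 beta e_t bounds the stationarity measure and Psi >= 0 for every value of
   the estimator. Integrating Psi over the fresh sample first gives
     E[Phi_{t+1} + N_{t+1}] + E e_t <= (1 + q) E[Phi_t + N_t] + c,
   and this recursion bounds min_t E e_t. All the integrands are nonnegative, so
   nothing has to be assumed finite. *)

Lemma ler_sqr_ge0 (R : realDomainType) (a b : R) : 0 <= a -> a <= b -> a ^+ 2 <= b ^+ 2.
Proof. by move=> a0 ab; rewrite lerXn2r ?nnegrE// (le_trans a0). Qed.

(** * The Euclidean inner product and norm *)

Section euclidean.
Context (R : realType) (n : nat).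
Implicit Types (u v w : 'rV[R]_n) (a b : R).

Lemma dotC u v : dot u v = dot v u.
Proof. by apply: eq_bigr => i _; rewrite mulrC. Qed.

Lemma dotDl u v w : dot (u + v) w = dot u w + dot v w.
Proof. by rewrite -big_split; apply: eq_bigr => i _; rewrite mxE mulrDl. Qed.

Lemma dotZl a u v : dot (a *: u) v = a * dot u v.
Proof. by rewrite mulr_sumr; apply: eq_bigr => i _; rewrite mxE mulrA. Qed.

Lemma dotNl u v : dot (- u) v = - dot u v.
Proof. by rewrite -scaleN1r dotZl mulN1r. Qed.

Lemma dotDr u v w : dot w (u + v) = dot w u + dot w v.
Proof. by rewrite dotC dotDl !(dotC w). Qed.

Lemma dotZr a u v : dot u (a *: v) = a * dot u v.
Proof. by rewrite dotC dotZl dotC. Qed.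

Lemma dotNr u v : dot u (- v) = - dot u v.
Proof. by rewrite dotC dotNl dotC. Qed.

Definition dotE := (dotDl, dotDr, dotZl, dotZr, dotNl, dotNr).

Lemma dot_ge0 u : 0 <= dot u u.
Proof. by apply: sumr_ge0 => i _; rewrite -expr2 sqr_ge0. Qed.

Lemma enorm_sqr u : enorm u ^+ 2 = dot u u.
Proof. by rewrite /enorm sqr_sqrtr// dot_ge0. Qed.

Lemma enorm_ge0 u : 0 <= enorm u.
Proof. exact: sqrtr_ge0. Qed.

Lemma dot_eq0 u : dot u u = 0 -> u = 0.
Proof.
move=> /eqP; rewrite psumr_eq0; last by move=> i _; rewrite -expr2 sqr_ge0.
move=> /allP h; apply/rowP => i; rewrite mxE; apply/eqP.
by have := h i (mem_index_enum i); rewrite implyTb mulf_eq0 orbb.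
Qed.

(** Cauchy-Schwarz, by expanding the square of [enorm v *: u - enorm u *: v] and dividing by the
    product of the norms once both are nonzero. *)
Lemma dot_le_enorm u v : dot u v <= enorm u * enorm v.
Proof.
have [u0|u0] := eqVneq (enorm u) 0.
  have -> : u = 0 by apply: dot_eq0; rewrite -enorm_sqr u0 expr0n.
  by rewrite -(scale0r 0) dotZl mul0r mulr_ge0 ?enorm_ge0.
have [v0|v0] := eqVneq (enorm v) 0.
  have -> : v = 0 by apply: dot_eq0; rewrite -enorm_sqr v0 expr0n.
  by rewrite -(scale0r 0) dotZr mul0r mulr_ge0 ?enorm_ge0.
have p : 0 < enorm u * enorm v by rewrite mulr_gt0// lt_neqAle eq_sym ?u0 ?v0 enorm_ge0.
rewrite -(ler_pM2l p); have := dot_ge0 (enorm v *: u - enorm u *: v).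
rewrite !dotE (dotC v u) -!enorm_sqr; lra.
Qed.

Lemma enormD u v : enorm (u + v) <= enorm u + enorm v.
Proof.
rewrite -(@ler_pXn2r _ 2)// ?nnegrE ?addr_ge0 ?enorm_ge0//.
rewrite enorm_sqr !dotE -!enorm_sqr (dotC v u).
by have := dot_le_enorm u v; nra.
Qed.

Lemma enormZ a u : 0 <= a -> enorm (a *: u) = a * enorm u.
Proof. by move=> a0; rewrite /enorm !dotE mulrA -expr2 sqrtrM ?sqr_ge0// sqrtr_sqr
  ger0_norm. Qed.

Lemma enormN u : enorm (- u) = enorm u.
Proof. by rewrite /enorm dotNl dotNr opprK. Qed.

Lemma enorm0 : enorm (0 : 'rV[R]_n) = 0.
Proof. by rewrite -(scale0r 0) enormZ// mul0r. Qed.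

Lemma enormD_sqr_le u v : enorm (u + v) ^+ 2 <= 2 * enorm u ^+ 2 + 2 * enorm v ^+ 2.
Proof.
rewrite !enorm_sqr; have := dot_ge0 (u - v); rewrite !dotE (dotC v u); lra.
Qed.

(** Young's inequality with weight 1/4, from the square of [u - 4 *: v]. It is the source of the
    constants 5 and 5/4 in [K1], [K2] and [K3]. *)
Lemma enormD_sqr_le54 u v : enorm
  (u + v) ^+ 2 <= 5 / 4 * enorm u ^+ 2 + 5 * enorm v ^+ 2.
Proof.
rewrite !enorm_sqr; have := dot_ge0 (u - 4 *: v); rewrite !dotE (dotC v u); lra.
Qed.

End euclidean.

(** * First-order inequalities for functions with Lipschitz gradient *)

Section smooth.
Context (R : realType) (n : nat).
Implicit Types (f : 'rV[R]_n -> R) (x y v : 'rV[R]_n).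

Lemma grad_dot f x v : differentiable f x -> 'D_v f x = dot (grad f x) v.
Proof.
move=> df; rewrite deriveE// [in LHS](row_sum_delta v) linear_sum.
apply: eq_bigr => i _; rewrite linearZ/= mxE deriveE//.
by rewrite mulrC.
Qed.

Lemma gradN f x : differentiable f x -> grad (fun z => - f z) x = - grad f x.
Proof.
move=> df; apply/rowP => i; rewrite !mxE deriveN//; exact: diff_derivable.
Qed.

Lemma is_derive_line f x v (s : R) : (forall z, differentiable f z) ->
  is_derive s 1 (fun s : R => f (x + s *: v)) (dot (grad f (x + s *: v)) v).
Proof.
move=> df; rewrite -grad_dot//.
have /= dv : derivable f (x + s *: v) v by exact: diff_derivable.
have E : (fun h : R => h^-1 *: (((fun s : R => f (x + s *: v)) \o shift s) (h *:
  (1 : R)) - f (x + s *: v)))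
   = (fun h : R => h^-1 *: ((f \o shift (x + s *: v)) (h *: v) - f (x + s *: v))).
  apply/funext => h /=; congr (_ *: (f _ - _)).
  by rewrite [h *: 1]mulr1 scalerDl addrCA.
split; first by rewrite /derivable E.
by rewrite /derive E.
Qed.

(** The mean value theorem replaces the usual integral: [phi] is [f] on the segment minus its
    quadratic model, and its derivative [dphi] is nonpositive on [0, 1] by Cauchy-Schwarz and the
    Lipschitz bound. *)
Lemma descent f (L : R) x y :
    (forall z, differentiable f z) ->
    (forall z1 z2, enorm (grad f z1 - grad f z2) <= L * enorm (z1 - z2)) ->
  f y <= f x + dot (grad f x) (y - x) + L / 2 * enorm (y - x) ^+ 2.
Proof.
move=> df Lf; set v := y - x.
pose phi (s : R) := f (x + s *: v) - s * dot (grad f x) v - s ^+ 2 *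
  (L / 2 * enorm v ^+ 2).
pose dphi (s : R) := dot (grad f (x + s *: v)) v - dot (grad f x) v - s *
  (L * enorm v ^+ 2).
have dphiE (s : R) : is_derive s 1 phi (dphi s).
  have H1 := is_derive_line x v s df.
  apply: is_derive_eq; rewrite /dphi.
  by rewrite /GRing.scale /= ; field.
have [|c c01] := @MVT_segment R phi dphi 0 1 ler01 (fun s _ => dphiE s).
  apply: continuous_subspaceT => s; apply/differentiable_continuous/derivable1_diffP.
  by have [] := dphiE s.
rewrite in_itv/= in c01; case/andP: c01 => c0 c1.
have xv : x + 1 *: v = y by rewrite scale1r /v addrCA subrr addr0.
rewrite /phi xv scale0r addr0 subr0 mulr1 expr1n expr0n/= !mul0r !mul1r !subr0.
have : dphi c <= 0.
  rewrite /dphi subr_le0.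
  rewrite -dotNl -dotDl; apply: le_trans (dot_le_enorm _ _) _.
  have := Lf (x + c *: v) x; rewrite addrAC subrr add0r enormZ// => h.
  by have := ler_wpM2r (enorm_ge0 v) h; lra.
lra.
Qed.

Lemma descent_lower f (L : R) x y :
    (forall z, differentiable f z) ->
    (forall z1 z2, enorm (grad f z1 - grad f z2) <= L * enorm (z1 - z2)) ->
  f x + dot (grad f x) (y - x) - L / 2 * enorm (y - x) ^+ 2 <= f y.
Proof.
move=> df Lf; have := @descent (fun z => - f z) L x y.
rewrite gradN// dotNl.
have d1 z : differentiable (fun z => - f z) z by exact: differentiableN.
move=> /(_ d1); have d2 z1 z2 : enorm (grad (fun z => - f z) z1 - grad
  (fun z => - f z) z2) <= L * enorm (z1 - z2).
  by rewrite !gradN// -opprD enormN.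
move=> /(_ d2); lra.
Qed.

(** A gradient step of length 1/L from [x] lowers [f] by at least |grad f x|^2 / (2 L), and [f]
    cannot fall below [m]. *)
Lemma grad_sqr_le f (L m : R) x : 0 < L ->
    (forall z, differentiable f z) ->
    (forall z1 z2, enorm (grad f z1 - grad f z2) <= L * enorm (z1 - z2)) ->
    (forall z, m <= f z) ->
  enorm (grad f x) ^+ 2 <= 2 * L * (f x - m).
Proof.
move=> L0 df Lf fm; have := @descent f L x (x - L^-1 *: grad f x) df Lf.
have := fm (x - L^-1 *: grad f x).
rewrite [x - _ - x]addrAC subrr add0r enormN enormZ ?invr_ge0 ?(ltW L0)// dotNr dotZr
  -enorm_sqr.
set F := f _; set e := enorm _ => h1 h2.
have e2 : L / 2 * (L^-1 * e) ^+ 2 = L^-1 * e ^+ 2 / 2 by field; rewrite gt_eqF.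
rewrite e2 in h2.
have : L^-1 * e ^+ 2 / 2 <= f x - m by lra.
have -> : L^-1 * e ^+ 2 / 2 = e ^+ 2 / (2 * L) by field; rewrite gt_eqF.
by rewrite ler_pdivrMr ?mulr_gt0// mulrC.
Qed.

(** Convexity bounds [f (x + s *: v)] from above and [descent_lower] bounds it from below. Dividing
    by [s] leaves an error proportional to [s], which is then made arbitrarily small. *)
Lemma weakly_convex_gradient f (l L : R) x y :
    (forall z, differentiable f z) ->
    (forall z1 z2, enorm (grad f z1 - grad f z2) <= L * enorm (z1 - z2)) ->
    convex_function setT (fun z => f z + l / 2 * enorm z ^+ 2) ->
  f x + dot (grad f x) (y - x) - l / 2 * enorm (y - x) ^+ 2 <= f y.
Proof.
move=> df Lf cf; set v := y - x; set e := enorm v ^+ 2.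
have e0 : 0 <= e by exact: sqr_ge0.
have K (s : R) : 0 < s -> s <= 1 ->
    dot (grad f x) v - l / 2 * e - (f y - f x) <= s * ((L - l) / 2 * e).
  move=> s0 s1; have := cf (Itv01 (ltW s0) s1) y x (mem_setT _) (mem_setT _).
  rewrite convRE /conv/=.
  have -> : s *: y + unstable.onem s *: x = x + s *: v.
    by apply/rowP => i; rewrite /v /unstable.onem !mxE; ring.
  have := descent_lower x (x + s *: v) df Lf.
  rewrite [x + _ - x]addrAC subrr add0r dotZr enormZ ?(ltW s0)// exprMn -/e.
  have quad : s * enorm y ^+ 2 + (1 - s) * enorm x ^+ 2 =
      enorm (x + s *: v) ^+ 2 + s * (1 - s) * e.
    by rewrite /e !enorm_sqr /v !dotE !(dotC _ x); ring.
  rewrite /unstable.onem => h1 h2; rewrite -(ler_pM2l s0).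
  have : l / 2 * (s * enorm y ^+ 2 + (1 - s) * enorm x ^+ 2) =
      l / 2 * (enorm (x + s *: v) ^+ 2 + s * (1 - s) * e) by rewrite quad.
  by move: h1 h2; lra.
apply/ler_addgt0Pr => eps eps0; rewrite -lerBlDl.
set c := (L - l) / 2 * e in K.
(* The sign of [c] is that of [L - l] and is unknown, hence the absolute value; the summand 1 keeps
   the denominator positive. *)
pose s := Num.min 1 (eps / (1 + `|c|)).
have c1 : 0 < 1 + `|c| by rewrite ltr_wpDr.
have s0 : 0 < s by rewrite lt_min ltr01 divr_gt0.
have s1 : s <= 1 by rewrite ge_min lexx.
have : s * c <= eps.
  apply: le_trans (_ : s * (1 + `|c|) <= _).
    by rewrite ler_pM2l// (le_trans (ler_norm _))// lerDr.
  by rewrite -ler_pdivlMr// ge_min lexx orbT.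
have := K s s0 s1; lra.
Qed.

End smooth.

(** * Optimality conditions of the y-, x- and u-updates *)

Section optimality.
Context (R : realType) (n : nat).
Implicit Types (f : 'rV[R]_n -> R) (F : 'rV[R]_n -> \bar R)
  (H : 'rV[R]_n -> 'rV[R]_n -> R) (x y z u v w : 'rV[R]_n).

(** Completing the square: comparing [y'] with the claimed minimizer and multiplying by 2 / beta
    shows that the squared distance between them is at most 0. *)
Lemma y_updateE H (beta : R) x y v y' : 0 < beta ->
  y_update H beta x y v y' -> y' = y - beta^-1 *: (v + grady H x y).
Proof.
move=> b0 /(_ (y - beta^-1 *: (v + grady H x y))); rewrite lee_fin.
move: (v + _) => c h; apply/eqP; rewrite -subr_eq0; apply/eqP/dot_eq0.
apply/le_anti; rewrite dot_ge0 andbT.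
have -> : y' - (y - beta^-1 *: c) = (y' - y) + beta^-1 *: c.
  by apply/rowP => i; rewrite !mxE; ring.
move: h; have -> : y - beta^-1 *: c - y = - (beta^-1 *: c).
  by apply/rowP => i; rewrite !mxE; ring.
rewrite -(ler_pM2l (_ : 0 < 2 / beta)) ?divr_gt0//.
move: (y' - y) => w h.
rewrite !enorm_sqr !dotE in h *; rewrite (dotC w c).
have E k : 2 / beta * (beta / 2 * k) = k by field; rewrite gt_eqF.
rewrite !mulrDr !E in h; lra.
Qed.

(** Fermat's rule in quantitative form. If [p] is the gradient of the subproblem at [x] and [c] the
    Lipschitz constant L + 1 / gamma, the step [- c^-1 *: p] lowers the objective by |p|^2 / (2 c),
    so that minimality forces [p = 0]. *)
Lemma x_updateE H (gamma L : R) y z x : 0 < gamma -> 0 < L ->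
    (forall x, differentiable (fun x' => H x' y) x) ->
    (forall x1 x2, enorm (gradx H x1 y - gradx H x2 y) <= L * enorm (x1 - x2)) ->
  x_update H gamma y z x -> z = x + gamma *: gradx H x y.
Proof.
move=> g0 L0 dH LH xP.
set p := gradx H x y + gamma^-1 *: (x - z).
suff p0 : p = 0.
  have /(congr1 (fun w => gamma *: w)) := p0.
  rewrite /p scaler0 scalerDr scalerA mulfV ?gt_eqF// scale1r => /eqP.
  rewrite addrA subr_eq0 => /eqP <-; by rewrite addrC.
have gE : grad (H^~ y) x = p - gamma^-1 *: (x - z) by rewrite addrK.
clearbody p; pose c := L + gamma^-1.
have c0 : 0 < c by rewrite addr_gt0// invr_gt0.
have := xP (x - c^-1 *: p); rewrite lee_fin.
have := @descent R n (fun x' => H x' y) L x (x - c^-1 *: p) dH LH.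
have -> : x - c^-1 *: p - x = - (c^-1 *: p) by apply/rowP => i; rewrite !mxE; ring.
have -> : x - c^-1 *: p - z = (x - z) - c^-1 *: p by rewrite addrAC.
rewrite gE !enorm_sqr !dotE.
set pp := dot p p; set d1 := dot x p; set d2 := dot z p.
rewrite !(dotC p) -/d1 -/d2 -/pp.
have -> : 1 / (2 * gamma) = gamma^-1 / 2 by field; rewrite gt_eqF.
have hc : c^-1 * (c^-1 * pp) * c = c^-1 * pp by field; rewrite gt_eqF.
move=> h1 h2.
have : c^-1 * pp <= 0 by rewrite /c in hc h1 h2 *; lra.
rewrite pmulr_rle0 ?invr_gt0// => pp0.
by apply/dot_eq0/le_anti; rewrite dot_ge0 andbT.
Qed.

Lemma u_update_fin F (gamma : R) x z u : proper_function F ->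
  u_update F gamma x z u -> F u \is a fin_num.
Proof.
move=> [FNy [w Fw]] /(_ w); rewrite fin_numE FNy/=.
by move: (F u) (F w) (FNy w) Fw => [a| |] [b| |].
Qed.

Lemma u_update_le F (gamma : R) x z u w : proper_function F ->
    u_update F gamma x z u -> F w \is a fin_num ->
  fine (F u) + 1 / (2 * gamma) * enorm (2 *: x - z - u) ^+ 2
    <= fine (F w) + 1 / (2 * gamma) * enorm (2 *: x - z - w) ^+ 2.
Proof.
move=> pF uP Fw; have Fu := u_update_fin pF uP.
by have := uP w; rewrite -(fineK Fu) -(fineK Fw) lee_fin.
Qed.

Lemma enorm_continuous : continuous (@enorm R n).
Proof.
move=> x; apply: (@continuous_comp _ _ _ (fun u => dot u u) Num.sqrt);
  last exact: sqrt_continuous.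
rewrite /dot; apply: (@continuous_big _ _ +%R) => [|i _]; first exact: add_continuous.
by move=> w; apply: (@cvgM R _ (nbhs w)); exact: (@coord_continuous R 1 n ord0 i w).
Qed.

(** Minimality gives F w >= F u + <v, w - u> - |w - u|^2 / (2 gamma), so [v] is already a regular
    subgradient at [u], and constant sequences make it a limiting one. *)
Lemma u_update_subdiff F (gamma : R) x z u : proper_function F -> 0 < gamma ->
  u_update F gamma x z u -> limiting_subdiff F u (gamma^-1 *: (2 *: x - z - u)).
Proof.
move=> pF g0 uP; have Fu := u_update_fin pF uP.
set v := gamma^-1 *: _.
split=> //; exists (fun=> u), (fun=> v); split; try exact: cvg_cst.
move=> _; split=> // e e0.
(* Within this radius the quadratic remainder |w - u|^2 / (2 gamma) is at most e |w - u|. *)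
have : \forall w \near u, enorm (w - u) < 2 * gamma * e.
  have : enorm (w - u) @[w --> u] --> enorm (u - u).
    apply: (@continuous_comp _ _ _ (fun w => w - u) (@enorm R n));
      last exact: enorm_continuous.
    by apply: (@cvgB R _ _ (nbhs u) _ id (fun=> u)); [exact: cvg_id|exact: cvg_cst].
  rewrite subrr enorm0 => /cvgr_lt/(_ (2 * gamma * e)) h; apply: h.
  by rewrite !mulr_gt0.
apply: filterS => w wu.
have := uP w; have [FNy _] := pF; have := FNy w.
rewrite -(fineK Fu); case: (F w) => [a _|_ _|//]; last by rewrite leey.
rewrite !lee_fin.
have -> : 2 *: x - z - w = (2 *: x - z - u) - (w - u).
  by apply/rowP => i; rewrite !mxE; ring.
rewrite /v dotZl; move: (2 *: x - z - u) (w - u) wu => q s wu.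
rewrite enorm_sqr [in X in _ <= X ->
  _]enorm_sqr (dotDl q) !(dotDr) !dotNr !dotNl (dotC s q).
have -> : 1 / (2 * gamma) = gamma^-1 / 2 by field; rewrite gt_eqF.
have : gamma^-1 / 2 * dot s s <= e * enorm s.
  rewrite -enorm_sqr expr2 mulrA ler_wpM2r ?enorm_ge0//.
  rewrite mulrAC ler_pdivrMr// mulrC ler_pdivrMr// (le_trans (ltW wu))//; lra.
lra.
Qed.

End optimality.

(** * Deterministic estimates for the x-, u- and z-steps *)

Section deterministic.
Context (R : realType) (n : nat).
Implicit Types (F : 'rV[R]_n -> \bar R) (x y z u v w : 'rV[R]_n).
Context (H : 'rV[R]_n -> 'rV[R]_n -> R) (gamma l L2s L4s : R).
Hypothesis gamma_gt0 : 0 < gamma.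
Hypothesis L2s_ge0 : 0 <= L2s.
Hypothesis Hx_diff : forall x y, differentiable (fun x' => H x' y) x.
Hypothesis H_L2 : forall x1 x2 y,
  enorm (gradx H x1 y - gradx H x2 y) <= L2s * enorm (x1 - x2).
Hypothesis H_L4 : forall x y1 y2,
  enorm (gradx H x y1 - gradx H x y2) <= L4s * enorm (y1 - y2).
Hypothesis H_wconvex : forall y,
  convex_function setT (fun x => H x y + l / 2 * enorm x ^+ 2).

Let K1 := (1 - (10 * (l + L2s) + 4) * gamma - 5 * L2s ^+ 2 * gamma ^+ 2)
          / (4 * gamma).
Let K2 := 5 * (1 + gamma * L2s) ^+ 2 / (4 * gamma ^+ 2).
Let K3 := L4s * (1 + 5 * gamma * L4s) + 5 * K1 * L4s ^+ 2 / K2.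

Let dist_sqr_gradx_le x y x' y' :
  enorm (gradx H x' y' - gradx H x y) ^+ 2
    <= 5 / 4 * (L2s * enorm (x' - x)) ^+ 2 + 5 * (L4s * enorm (y' - y)) ^+ 2.
Proof.
have -> : gradx H x' y' - gradx H x y =
    (gradx H x' y' - gradx H x y') + (gradx H x y' - gradx H x y).
  by rewrite addrA subrK.
apply: le_trans (enormD_sqr_le54 _ _) _.
apply: lerD; rewrite ler_pM2l ?divr_gt0// ler_sqr_ge0 ?enorm_ge0//.
Qed.

(** The two expressions for [z] give u - x as x' - x plus gamma times the change of [gradx H] from
    (x, y) to (x', y'). Splitting this change at (x, y') and applying Young's inequality produces
    [K2]. *)
Lemma residual_sqr_le x y u z x' y' :
    z = x + gamma *: gradx H x y + (u - x) ->
    z = x' + gamma *: gradx H x' y' ->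
  enorm (u - x) ^+ 2 <= gamma ^+ 2 * K2 * enorm (x' - x) ^+ 2
                        + 5 * gamma ^+ 2 * L4s ^+ 2 * enorm (y' - y) ^+ 2.
Proof.
move=> -> e.
have -> : u - x = ((x' - x) + gamma *: (gradx H x' y' - gradx H x y'))
                + gamma *: (gradx H x y' - gradx H x y).
  apply/rowP => i; move/rowP : e => /(_ i); rewrite !mxE; lra.
apply: le_trans (enormD_sqr_le54 _ _) _.
apply: lerD.
  have -> : gamma ^+ 2 * K2 * enorm (x' - x) ^+ 2 =
      5 / 4 * ((1 + gamma * L2s) * enorm (x' - x)) ^+ 2.
    by rewrite /K2; field; rewrite gt_eqF.
  rewrite ler_pM2l ?divr_gt0// ler_sqr_ge0 ?enorm_ge0//.
  apply: le_trans (enormD _ _) _; rewrite enormZ ?(ltW gamma_gt0)//.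
  by rewrite mulrDl mul1r lerD2l -mulrA ler_pM2l.
have -> : 5 * gamma ^+ 2 * L4s ^+ 2 * enorm (y' - y) ^+ 2 =
   5 * (gamma * (L4s * enorm (y' - y))) ^+ 2 by ring.
rewrite enormZ ?(ltW gamma_gt0)//.
have h : enorm (gradx H x y' - gradx H x y) <= L4s * enorm (y' - y) by [].
rewrite ler_pM2l// ler_sqr_ge0 ?mulr_ge0 ?enorm_ge0 ?(ltW gamma_gt0)//.
by rewrite ler_pM2l.
Qed.

(** The lower bound from weak convexity cannot exceed the upper bound from [descent]. Keeping the
    norm as a factor covers n = 0, where the sign of [l + L2s] is not determined. *)
Lemma wconvex_ge x x' y : 0 <= (l + L2s) * enorm (x' - x) ^+ 2.
Proof.
have h1 := @weakly_convex_gradient R n (fun x => H x y) l L2s x x'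
  (Hx_diff^~ y) (fun a b => H_L2 a b y) (@H_wconvex y).
have h2 := @descent R n (fun x => H x y) L2s x x'
  (Hx_diff^~ y) (fun a b => H_L2 a b y).
by lra.
Qed.

(** Minimality of [u'] and weak convexity of [H] at [x'] give a decrease in |x' - x|^2, up to |x' -
    u|^2 / gamma. The latter is gamma times a squared change of [gradx H]; what survives of the
    decrease is at least K1 |x' - x|^2, and [residual_sqr_le] converts it into |u - x|^2. *)
Lemma merit_descent F x y u z x' y' u' z' : proper_function F ->
    0 < K1 -> 0 <= L4s ->
    z = x + gamma *: gradx H x y + (u - x) -> F u \is a fin_num ->
    z = x' + gamma *: gradx H x' y' ->
    u_update F gamma x' z u' -> z' = z + (u' - x') ->
  H x' y' + fine (merit F gamma x' u' z')
      + K1 / (K2 * gamma ^+ 2) * enorm (u - x) ^+ 2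
    <= H x y' + fine (merit F gamma x u z) + K3 * enorm (y' - y) ^+ 2.
Proof.
move=> pF K1_gt0 L4s_ge0 ez Fu ez' uP ->.
have Fu' := u_update_fin pF uP.
rewrite /merit -(fineK Fu) -(fineK Fu')/=.
have hu := u_update_le pF uP Fu.
have hx := @weakly_convex_gradient R n (fun x => H x y') l L2s x' x
  (Hx_diff^~ y') (fun a b => H_L2 a b y') (@H_wconvex y').
have hr := residual_sqr_le ez ez'.
have hg := dist_sqr_gradx_le x y x' y'.
have hl := wconvex_ge x x' y.
have L2_gt0 : 0 < 1 + gamma * L2s.
  by rewrite (lt_le_trans ltr01)// lerDl mulr_ge0// ltW.
have K2_gt0 : 0 < K2.
  by apply: divr_gt0; apply: mulr_gt0 => //; exact: exprn_gt0.
have eu : x' - u = - gamma *: (gradx H x' y' - gradx H x y).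
  move: ez'; rewrite ez => e.
  apply/rowP => i; move/rowP : e => /(_ i); rewrite !mxE; lra.
have eg : grad (H^~ y') x' = gamma^-1 *: (z - x').
  by rewrite ez' addrAC subrr add0r scalerA mulVf ?gt_eqF// scale1r.
rewrite eg in hx.
(* After the z-update the new merit equals F u' + |2 x' - z - u'|^2 / (2 gamma) - |x' - z|^2 / (2
   gamma), which is the objective of the u-step at [u'] up to a term free of [u']; hence [hu]
   applies. *)
have Q : fine (F u') + 1 / (2 * gamma) * enorm (2 *: x' - u' - (z + (u' - x'))) ^+ 2
     - 1 / (2 * gamma) * enorm (x' - (z + (u' - x'))) ^+ 2 - 1 / gamma * enorm
       (u' - x') ^+ 2
   + H x' y' <= fine (F u) + 1 / (2 * gamma) * enorm (2 *: x - u - z) ^+ 2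
     - 1 / (2 * gamma) * enorm (x - z) ^+ 2 - 1 / gamma * enorm (u - x) ^+ 2
    + H x y' + gamma^-1 * enorm (x' - u) ^+ 2
     - (gamma^-1 - l) / 2 * enorm (x' - x) ^+ 2.
  have i2 : 1 / (2 * gamma) = gamma^-1 / 2 by field; rewrite gt_eqF.
  have i1 : 1 / gamma = gamma^-1 by rewrite mul1r.
  have sx : enorm (x - x') = enorm (x' - x) by rewrite -enormN opprB.
  rewrite sx in hx.
  move: hu hx; rewrite !i1 !i2.
  have -> : (gamma^-1 - l) / 2 * enorm (x' - x) ^+ 2 =
    gamma^-1 / 2 * enorm (x' - x) ^+ 2 - l / 2 * enorm (x' - x) ^+ 2 by ring.
  move: (l / 2 * enorm (x' - x) ^+ 2) => le.
  rewrite !enorm_sqr !dotE ?(dotC x' x) ?(dotC u x) ?(dotC u' x) ?(dotC z x).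
  rewrite ?(dotC u x') ?(dotC u' x') ?(dotC z x') ?(dotC u' u) ?(dotC z u) ?(dotC z u').
  move: (gamma^-1) => gi; lra.
have xu : gamma^-1 * enorm (x' - u) ^+ 2 =
    gamma * enorm (gradx H x' y' - gradx H x y) ^+ 2.
  by rewrite eu scaleNr enormN enormZ ?(ltW gamma_gt0)//; field; rewrite gt_eqF.
rewrite xu in Q.
have K2n : K2 != 0 by exact: lt0r_neq0.
have hr' : K1 / (K2 * gamma ^+ 2) * enorm (u - x) ^+ 2 <=
    K1 * enorm (x' - x) ^+ 2 + 5 * K1 * L4s ^+ 2 / K2 * enorm (y' - y) ^+ 2.
  have -> : K1 * enorm (x' - x) ^+ 2 + 5 * K1 * L4s ^+ 2 / K2 * enorm (y' - y) ^+ 2 =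
    K1 / (K2 * gamma ^+ 2) * (gamma ^+ 2 * K2 * enorm (x' - x) ^+ 2
                        + 5 * gamma ^+ 2 * L4s ^+ 2 * enorm (y' - y) ^+ 2).
    by field; rewrite K2n gt_eqF.
  rewrite ler_wpM2l//; apply/ltW/divr_gt0 => //.
  by apply: mulr_gt0 => //; exact: exprn_gt0.
have hg' : gamma * enorm (gradx H x' y' - gradx H x y) ^+ 2 <=
    5 / 4 * gamma * L2s ^+ 2 * enorm (x' - x) ^+ 2 +
    5 * gamma * L4s ^+ 2 * enorm (y' - y) ^+ 2.
  have -> : 5 / 4 * gamma * L2s ^+ 2 * enorm (x' - x) ^+ 2 +
    5 * gamma * L4s ^+ 2 * enorm (y' - y) ^+ 2 = gamma *
    (5 / 4 * (L2s * enorm (x' - x)) ^+ 2 + 5 * (L4s * enorm (y' - y)) ^+ 2) by ring.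
  by rewrite ler_pM2l.
have K3E : K3 * enorm (y' - y) ^+ 2 = L4s * enorm (y' - y) ^+ 2 +
    5 * gamma * L4s ^+ 2 * enorm (y' - y) ^+ 2 +
    5 * K1 * L4s ^+ 2 / K2 * enorm (y' - y) ^+ 2 by rewrite /K3; ring.
have K1E : K1 * enorm (x' - x) ^+ 2 = gamma^-1 / 4 * enorm (x' - x) ^+ 2
   - (5 / 2 * (l + L2s) + 1) * enorm (x' - x) ^+ 2
   - 5 / 4 * gamma * L2s ^+ 2 * enorm (x' - x) ^+ 2.
  by rewrite /K1; field; rewrite gt_eqF.
(* The coefficient (1 / gamma - l) / 2 - (5 / 4) gamma L2s^2 exceeds [K1] by 1 / (4 gamma) + 2 (l +
   L2s) + L2s / 2 + 1. Multiplied by |x' - x|^2, each of these terms is nonnegative, the second by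
   [hl]. *)
have p1 : 0 <= L4s * enorm (y' - y) ^+ 2 by rewrite mulr_ge0 ?sqr_ge0.
have p2 : 0 <= L2s * enorm (x' - x) ^+ 2 by rewrite mulr_ge0 ?sqr_ge0.
have p3 : 0 <= gamma^-1 * enorm (x' - x) ^+ 2
  by rewrite mulr_ge0 ?sqr_ge0// invr_ge0 ltW.
have p4 : 0 <= enorm (x' - x) ^+ 2 by rewrite sqr_ge0.
lra.
Qed.

(** Here [z] is the point fed to the x- and u-updates, before the z-update. The subgradient supplied
    by the u-step gives the element [w], whose norm is at most (L2s + 1 / gamma) |u - x|. *)
Lemma dist0_subdiff_le F x y u z : proper_function F ->
    z = x + gamma *: gradx H x y -> u_update F gamma x z u ->
  (dist0 [set (gradx H u y + v)%R | v in limiting_subdiff F u] ^+ 2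
    <= (((1 + gamma * L2s) / gamma) ^+ 2 * enorm (u - x) ^+ 2)%:E)%E.
Proof.
move=> pF ez uP.
set w := gradx H u y + gamma^-1 *: (2 *: x - z - u).
have wE : w = (gradx H u y - gradx H x y) - gamma^-1 *: (u - x).
  rewrite /w ez; apply/rowP => i; rewrite !mxE; field; by rewrite gt_eqF.
have d0 : (0 <= dist0 [set (gradx H u y + v)%R | v in limiting_subdiff F u])%E.
  by apply: le_ereal_inf_tmp => _ [s _ <-]; rewrite lee_fin enorm_ge0.
have dw : (dist0 [set (gradx H u y + v)%R | v in limiting_subdiff F u] <=
  (enorm w)%:E)%E.
  apply: ereal_inf_lbound; exists w => //.
  by exists (gamma^-1 *: (2 *: x - z - u)) => //; exact: (u_update_subdiff pF).
apply: (@le_trans _ _ ((enorm w ^+ 2)%:E)).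
  by rewrite EFin_expe !expe2; apply: lee_pmul.
rewrite lee_fin -exprMn ler_sqr_ge0 ?enorm_ge0//.
rewrite wE; apply: le_trans (enormD _ _) _.
rewrite enormN enormZ ?invr_ge0 ?(ltW gamma_gt0)//.
have -> : (1 + gamma * L2s) / gamma = L2s + gamma^-1 by field; rewrite gt_eqF.
by rewrite mulrDl lerD2r.
Qed.

End deterministic.

(** * Borel measurability on R^n and on its square *)

Section borel.
Context (R : realType) (n : nat).

Lemma borelRn_open (A : set 'rV[R]_n) : open A -> measurable (A : set (borelRn R n)).
Proof. exact: sub_sigma_algebra. Qed.

Lemma continuous_borelRn_measurable (f : 'rV[R]_n -> R) :
  continuous f -> measurable_fun setT (f : borelRn R n -> R).
Proof.
move=> /continuousP cf; apply: (measurability _ (RGenOpens.measurableE R)).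
by move=> _ [_ [a [b ->] <-]]; rewrite setTI; apply: borelRn_open; apply: cf;
  exact: interval_open.
Qed.

Lemma lower_semicontinuous_borelRn_measurable (F : 'rV[R]_n -> \bar R) :
  lower_semicontinuous F -> measurable_fun setT (F : borelRn R n -> \bar R).
Proof.
move=> scF; apply: (measurability _ (ErealGenOInfty.measurableE R)).
move=> /= _ [_ [a ->]] <-; apply: measurableI => //; apply: borelRn_open.
by rewrite preimage_itvoy; move/lower_semicontinuousP : scF; exact.
Qed.

Lemma rational_ball (x : 'rV[R]_n) (e : R) : 0 < e ->
  exists p : 'rV[rat]_n, ball (map_mx (@ratr R) p) e x.
Proof.
move=> e0; have /choice[q qP] : forall i, exists q : rat, `|ratr q - x ord0 i| < e.
  move=> i; have /rat_in_itvoo[q] : x ord0 i - e < x ord0 i + e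
    by rewrite ltrBlDr -addrA ltrDl addr_gt0.
  by rewrite in_itv/= => h; exists q; rewrite ltr_distl.
exists (\row_i q i); split=> // i j; rewrite (ord1 i) !mxE; exact: qP.
Qed.

(** The product type carries the product sigma-algebra, generated by rectangles. An open set belongs
    to it as a countable union of products of balls with rational centres and radii 1 / (m + 1). *)
Lemma open2_borelRn_measurable (O : set ('rV[R]_n * 'rV[R]_n)) :
  open O -> measurable (O : set (borelRn R n * borelRn R n)).
Proof.
move=> oO.
pose B (c : 'rV[rat]_n * 'rV[rat]_n * nat) : set ('rV[R]_n * 'rV[R]_n) :=
  ball (map_mx (@ratr R) c.1.1) c.2.+1%:R^-1 `*` ball (map_mx
    (@ratr R) c.1.2) c.2.+1%:R^-1.
pose U (k : nat) : set (borelRn R n * borelRn R n) :=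
  if unpickle k is Some c then if `[< B c `<=` O >] then B c else set0 else set0.
have -> : O = \bigcup_k U k.
  apply/seteqP; split=> [[x y] Oxy|z [k _]]; last first.
    rewrite /U; case: unpickle => // c; case: asboolP => // BO; exact: BO.
  have /nbhs_ballP[e /= e0 eO] : nbhs (x, y) O by exact: open_nbhs_nbhs.
  (* Any point of a ball of radius 1 / (m + 1) containing [x] is within 2 / (m + 1) of [x], hence
     the half of [e]. *)
  have [m me] : exists m : nat, m.+1%:R^-1 < e / 2.
    by have [m _ h] := near_infty_natSinv_lt (PosNum (divr_gt0 e0 (ltr0Sn R 1)));
      exists m; apply: h => /=.
  have me2 : m.+1%:R^-1 + m.+1%:R^-1 <= e by move: me; move: (m.+1%:R^-1) => r; lra.
  have m0 : 0 < m.+1%:R^-1 :> R by rewrite invr_gt0.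
  have [p px] := rational_ball x m0; have [q qy] := rational_ball y m0.
  exists (pickle (p, q, m)) => //; rewrite /U pickleK.
  case: asboolP => [_|]; first by split.
  case=> -[x' y'] [/= px' qy']; apply: eO; split => /=.
  - apply: (@le_ball _ _ _ (m.+1%:R^-1 + m.+1%:R^-1)); first exact: me2.
    exact: ball_triangle (ball_sym px) px'.
  - apply: (@le_ball _ _ _ (m.+1%:R^-1 + m.+1%:R^-1)); first exact: me2.
    exact: ball_triangle (ball_sym qy) qy'.
apply: bigcupT_measurable => k; rewrite /U; case: unpickle => // c;
  case: asboolP => // _.
by apply: measurableX; apply: borelRn_open; exact: ball_open.
Qed.

Lemma continuous2_borelRn_measurable (f : 'rV[R]_n * 'rV[R]_n -> R) :
  continuous f -> measurable_fun setT (f : borelRn R n * borelRn R n -> R).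
Proof.
move=> /continuousP cf; apply: (measurability _ (RGenOpens.measurableE R)).
by move=> _ [_ [a [b ->] <-]]; rewrite setTI; apply: open2_borelRn_measurable;
  apply: cf; exact: interval_open.
Qed.

End borel.

(** * Integration over an independent sample *)

Section independence.
Context d1 d2 d3 (T : measurableType d1) (S : measurableType d2)
  (V : measurableType d3) (R : realType) (P : probability T R)
  (D : probability S R).

(** The joint law of [X] and [xi] agrees on rectangles with the product of the law of [X] and [D],
    hence equals it; Tonelli's theorem does the rest. *)
Lemma ge0_integral_independent (X : T -> V) (xi : T -> S) (h : V * S -> \bar R) :
    measurable_fun setT X -> measurable_fun setT xi ->
    (forall E B, measurable E -> measurable B ->
       P (X @^-1` E `&` xi @^-1` B) = (P (X @^-1` E) * D B)%E) ->
    measurable_fun setT h -> (forall p, 0 <= h p)%E ->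
  (\int[P]_w h (X w, xi w) = \int[P]_w \int[D]_s h (X w, s))%E.
Proof.
move=> mX mxi ind mh h0.
pose X' : {mfun T >-> V} := HB.pack X (isMeasurableFun.Build _ _ _ _ X mX).
have mXxi : measurable_fun setT (fun w => (X w, xi w)) by exact: measurable_fun_pair.
pose J : {mfun T >-> (V * S)%type} :=
  HB.pack (fun w => (X w, xi w)) (isMeasurableFun.Build _ _ _ _ _ mXxi).
transitivity (\int[distribution P J]_p h p)%E.
  by rewrite ge0_integral_distribution.
transitivity (\int[distribution P X' \x D]_p h p)%E.
  apply: eq_measure_integral => A mA _.
  apply/esym/product_measure_unique => [E B mE mB|]; [exact: ind|exact: mA].
rewrite fubini_tonelli1//.
rewrite ge0_integral_distribution//.
  exact: measurable_fun_fubini_tonelli_F.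
by move=> v; exact: integral_ge0.
Qed.

(* [ge0_le_integral] asks for measurability, which is not known for the distance
   from 0 to the subdifferential; the integral of a nonnegative function is
   defined as a lower integral, so that it is not needed here. *)
Lemma ge0_le_integral_lower (f1 f2 : T -> \bar R) :
    (forall x, 0 <= f1 x)%E -> (forall x, f1 x <= f2 x)%E ->
  (\int[P]_x f1 x <= \int[P]_x f2 x)%E.
Proof.
move=> f10 f12; have f20 x : (0 <= f2 x)%E by exact: le_trans (f12 x).
rewrite !ge0_integralTE//; apply: ge_ereal_sup => _ [h hf <-]; apply: ereal_sup_ubound.
by exists h => // x; exact: le_trans (f12 x).
Qed.

End independence.

(** * Measurability of vector-valued maps, coordinate by coordinate *)

Section measurable_vectors.
Context (R : realType) (n : nat) d (T : measurableType d).
Implicit Types u v : T -> 'rV[R]_n.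

Lemma norm_coord_le_enorm (u : 'rV[R]_n) i : `|u ord0 i| <= enorm u.
Proof.
rewrite -sqrtr_sqr /enorm ler_wsqrtr// /dot (bigD1 i)//= -expr2 lerDl.
by apply: sumr_ge0 => j _; rewrite -expr2 sqr_ge0.
Qed.

Lemma measurable_dot u v :
  (forall i, measurable_fun setT (fun w => u w ord0 i)) ->
  (forall i, measurable_fun setT (fun w => v w ord0 i)) ->
  measurable_fun setT (fun w => dot (u w) (v w)).
Proof. by move=> mu mv; apply: measurable_sum => i; exact: measurable_funM. Qed.

Lemma measurable_enorm_sqr u :
  (forall i, measurable_fun setT (fun w => u w ord0 i)) ->
  measurable_fun setT (fun w => enorm (u w) ^+ 2).
Proof.
move=> mu; under eq_fun do rewrite enorm_sqr.
exact: measurable_dot.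
Qed.

Lemma measurable_coord (u : T -> borelRn R n) i :
  measurable_fun setT u -> measurable_fun setT (fun w => (u w : 'rV[R]_n) ord0 i).
Proof.
move=> mu; apply: (@measurableT_comp _ _ _ _ _ _ (fun v : borelRn R n =>
  (v : 'rV[R]_n) ord0 i)) => //.
apply: continuous_borelRn_measurable.
exact: coord_continuous.
Qed.

Lemma measurable_vecD u v i :
  (forall i, measurable_fun setT (fun w => u w ord0 i)) ->
  (forall i, measurable_fun setT (fun w => v w ord0 i)) ->
  measurable_fun setT (fun w => (u w + v w) ord0 i).
Proof. by move=> mu mv; under eq_fun do rewrite mxE; exact: measurable_funD. Qed.

Lemma measurable_vecB u v i :
  (forall i, measurable_fun setT (fun w => u w ord0 i)) ->
  (forall i, measurable_fun setT (fun w => v w ord0 i)) ->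
  measurable_fun setT (fun w => (u w - v w) ord0 i).
Proof. by move=> mu mv; under eq_fun do rewrite !mxE; exact: measurable_funB. Qed.

End measurable_vectors.

(** * Expectation of a quadratic function of the gradient estimator *)

Section estimator.
Context (R : realType) (n : nat) d (S : measurableType d) (D : probability S R).

(** The integrand may change sign, so linearity rests on integrability, which the second moment
    bound provides. The linear term is then computed by unbiasedness and the quadratic one bounded
    by [m]. *)
Lemma integral_quadratic_estimator (g : S -> 'rV[R]_n) (a p : 'rV[R]_n) (c k m : R) :
    (forall i, measurable_fun setT (fun s => g s ord0 i)) ->
    (forall i, \int[D]_s (g s ord0 i)%:E = (a ord0 i)%:E)%E ->
    (\int[D]_s (enorm (g s) ^+ 2)%:E <= m%:E)%E -> 0 <= k ->
  (\int[D]_s (c + dot p (g s) + k * enorm (g s) ^+ 2)%:E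
    <= (c + dot p a + k * m)%:E)%E.
Proof.
move=> mg ga gm k0.
have mg2 := measurable_enorm_sqr mg.
have ig2 : D.-integrable setT (fun s => (enorm (g s) ^+ 2)%:E).
  apply/integrableP; split; first exact/measurable_EFinP.
  under eq_integral do rewrite gee0_abs ?lee_fin ?sqr_ge0//.
  exact: le_lt_trans gm (ltry _).
have ic (r : R) : D.-integrable setT (EFin \o cst r).
  exact: finite_measure_integrable_cst.
have ig i : D.-integrable setT (fun s => (g s ord0 i)%:E).
  (* A coordinate is at most the norm r of the vector, and r <= 1 + r^2. *)
  apply: (@le_integrable _ _ _ D _ measurableT _ (fun s => (1 + enorm (g s) ^+ 2)%:E)).
  - exact/measurable_EFinP.
  - move=> s _; rewrite lee_fin [leRHS]ger0_norm ?addr_ge0 ?sqr_ge0//.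
    apply: (le_trans (norm_coord_le_enorm (g s) i)).
    have := sqr_ge0 (enorm (g s) - 1); have := enorm_ge0 (g s); lra.
  - under eq_fun do rewrite EFinD.
    exact: (integrableD measurableT (ic 1) ig2).
have iZ i : D.-integrable setT (fun s => ((p ord0 i)%:E * (g s ord0 i)%:E)%E).
  by apply: integrableZl.
have idot : D.-integrable setT (fun s => (dot p (g s))%:E).
  under eq_fun do rewrite /dot -sumEFin.
  by apply: integrable_sum => // i _; exact: iZ.
have Edot : (\int[D]_s (dot p (g s))%:E = (dot p a)%:E)%E.
  under eq_integral do rewrite /dot -sumEFin.
  rewrite integral_sum//; rewrite /dot -sumEFin; apply: eq_bigr => i _.
  by under eq_integral do rewrite EFinM; rewrite integralZl// ga.
have Ec : (\int[D]_s (EFin \o cst c) s = c%:E)%E.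
  transitivity (c%:E * D setT)%E; first exact: (integral_cst D measurableT c%:E).
  by transitivity (c%:E * 1)%E; [congr (_ * _)%E; exact: probability_setT|exact: mule1].
have ik : D.-integrable setT (fun s => (k%:E * (enorm (g s) ^+ 2)%:E)%E)
  by apply: integrableZl.
under eq_integral do rewrite -addrA EFinD [(dot _ _ + _)%:E]EFinD EFinM.
rewrite (integralD measurableT (ic c)); last exact: integrableD.
rewrite (integralD measurableT idot ik) Edot Ec.
rewrite integralZl// -addrA !EFinD leeD2l// leeD2l// EFinM lee_wpmul2l//.
Qed.

End estimator.

(** * Joint continuity from separate smoothness *)

Section continuity.
Context (R : realType) (n : nat).

Lemma continuous_dominated (T : topologicalType) (f e : T -> R) (p0 : T) :
  {for p0, continuous e} -> e p0 = 0 -> (forall p, `|f p - f p0| <= e p) ->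
  {for p0, continuous f}.
Proof.
move=> ce e0 h; apply/cvgrPdist_lt => eps eps0.
move/cvgrPdist_lt : ce => /(_ _ eps0); rewrite e0; apply: filterS => p.
rewrite sub0r normrN distrC; apply: le_lt_trans.
by rewrite (le_trans (h p))// ler_norm.
Qed.

Lemma enorm_subr_continuous (y0 : 'rV[R]_n) : continuous (fun y : 'rV[R]_n => enorm
  (y - y0)).
Proof.
move=> y; apply: (@continuous_comp _ _ _ (fun w : 'rV[R]_n => w - y0) (@enorm R n));
  last exact: enorm_continuous.
by apply: (@cvgB R _ _ (nbhs y) _ id (fun=> y0)); [exact: cvg_id|exact: cvg_cst].
Qed.

Lemma lipschitz_coord_continuous (f : 'rV[R]_n -> 'rV[R]_n) (L : R) i :
  (forall y1 y2, enorm (f y1 - f y2) <= L * enorm (y1 - y2)) ->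
  continuous (fun y => f y ord0 i).
Proof.
move=> Lf y0; apply: (@continuous_dominated 'rV[R]_n (fun y => f y ord0 i)
  (fun y => L * enorm (y - y0))).
- by apply: (@cvgM R _ (nbhs y0)); [exact: cvg_cst|exact: enorm_subr_continuous].
- by rewrite subrr enorm0 mulr0.
move=> y; apply: le_trans (Lf y y0); have := norm_coord_le_enorm (f y - f y0) i.
by rewrite !mxE.
Qed.

Lemma enorm_fst_continuous (a : 'rV[R]_n) :
  continuous (fun p : 'rV[R]_n * 'rV[R]_n => enorm (p.1 - a)).
Proof.
move=> p; apply: (@continuous_comp _ _ _ fst (fun x : 'rV[R]_n => enorm (x - a))).
  exact: cvg_fst.
exact: enorm_subr_continuous.
Qed.

Lemma enorm_snd_continuous (a : 'rV[R]_n) :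
  continuous (fun p : 'rV[R]_n * 'rV[R]_n => enorm (p.2 - a)).
Proof.
move=> p; apply: (@continuous_comp _ _ _ snd (fun x : 'rV[R]_n => enorm (x - a))).
  exact: cvg_snd.
exact: enorm_subr_continuous.
Qed.

Lemma lipschitz2_coord_continuous (f : 'rV[R]_n -> 'rV[R]_n -> 'rV[R]_n) (Lx Ly : R) i :
  (forall x1 x2 y, enorm (f x1 y - f x2 y) <= Lx * enorm (x1 - x2)) ->
  (forall x y1 y2, enorm (f x y1 - f x y2) <= Ly * enorm (y1 - y2)) ->
  continuous (fun p : 'rV[R]_n * 'rV[R]_n => f p.1 p.2 ord0 i).
Proof.
move=> Lfx Lfy [x0 y0].
apply: (@continuous_dominated ('rV[R]_n * 'rV[R]_n)%type (fun p => f p.1 p.2 ord0 i)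
  (fun p => Lx * enorm (p.1 - x0) + Ly * enorm (p.2 - y0)) (x0, y0)).
- apply: (@cvgD R _ _ (nbhs (x0, y0))); apply: (@cvgM R _ (nbhs (x0, y0)));
  try exact: cvg_cst.
    exact: enorm_fst_continuous.
  exact: enorm_snd_continuous.
- by rewrite /= !subrr enorm0 !mulr0 addr0.
move=> [x y] /=; apply: le_trans (lerD (Lfx x x0 y) (Lfy x0 y y0)).
apply: le_trans (enormD _ _); rewrite addrA subrK.
by have := norm_coord_le_enorm (f x y - f x0 y0) i; rewrite !mxE.
Qed.

(** Only separate differentiability of [H] is assumed. The increment is split at (x, y0): the x-part
    is continuous at fixed [y0], and the y-part is controlled by the two descent inequalities,
    uniformly for [x] near [x0] since [grady H x y0] is Lipschitz in [x]. *)
Lemma smooth2_continuous (H : 'rV[R]_n -> 'rV[R]_n -> R) (Lx Ly : R) :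
  (forall x y, differentiable (fun x' => H x' y) x) ->
  (forall x y, differentiable (fun y' => H x y') y) ->
  (forall x1 x2 y, enorm (grady H x1 y - grady H x2 y) <= Lx * enorm (x1 - x2)) ->
  (forall x y1 y2, enorm (grady H x y1 - grady H x y2) <= Ly * enorm (y1 - y2)) ->
  continuous (fun p : 'rV[R]_n * 'rV[R]_n => H p.1 p.2).
Proof.
move=> dx dy Lfx Lfy [x0 y0].
pose b (p : 'rV[R]_n * 'rV[R]_n) :=
  (enorm (grady H x0 y0) + Lx * enorm (p.1 - x0)) * enorm (p.2 - y0)
  + Ly / 2 * enorm (p.2 - y0) * enorm (p.2 - y0).
have c1 := @enorm_fst_continuous x0 (x0, y0).
have c2 := @enorm_snd_continuous y0 (x0, y0).
apply: (@continuous_dominated ('rV[R]_n * 'rV[R]_n)%type (fun p => H p.1 p.2)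
  (fun p => `|H p.1 y0 - H x0 y0| + b p) (x0, y0)).
- apply: (@cvgD R _ _ (nbhs (x0, y0))).
    apply: (@cvg_norm _ _ _ (nbhs (x0, y0))); apply: (@cvgB R _ _ (nbhs (x0, y0)));
      last exact: cvg_cst.
    apply: (@continuous_comp _ _ _ fst (fun x => H x y0)); first exact: cvg_fst.
    exact: differentiable_continuous.
  by apply: (@cvgD R _ _ (nbhs (x0, y0))); apply: (@cvgM R _ (nbhs (x0, y0))) => //;
    [apply: (@cvgD R _ _ (nbhs (x0, y0)))|]; try exact: cvg_cst;
    apply: (@cvgM R _ (nbhs (x0, y0))) => //; exact: cvg_cst.
- by rewrite /b /= !subrr enorm0 normr0 !mulr0 !addr0.
move=> [x y] /=.
have -> : H x y - H x0 y0 = (H x y0 - H x0 y0) + (H x y - H x y0) by ring.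
apply: le_trans (ler_normD _ _) _; rewrite lerD2l /b /=.
have h1 := @descent R n (H x) Ly y0 y (dy x) (Lfy x).
have h2 := @descent_lower R n (H x) Ly y0 y (dy x) (Lfy x).
have h3 : `|dot (grady H x y0) (y - y0)| <= enorm (grady H x y0) * enorm (y - y0).
  by rewrite ler_norml lerNl -dotNl -{1}(enormN (grady H x y0)) !dot_le_enorm.
have h4 : enorm (grady H x y0) <= enorm (grady H x0 y0) + Lx * enorm (x - x0).
  have -> : grady H x y0 = grady H x0 y0 + (grady H x y0 - grady H x0 y0).
    by rewrite addrC subrK.
  by apply: le_trans (enormD _ _) _; rewrite lerD2l.
have h5 := ler_wpM2r (enorm_ge0 (y - y0)) h4.
have := le_trans h3 h5; rewrite ler_norml => /andP[h6 h7].
rewrite -/(grady H x y0) in h1 h2.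
rewrite ler_norml -mulrA -expr2; apply/andP; split; lra.
Qed.

End continuity.

(* Evaluated at the value v of the gradient estimator, this bounds from above
   the objective after the y-step, plus the gradient term to be summed, plus
   K |y' - y|^2. Being nonnegative for every v, it can be averaged over the
   sample by Tonelli's theorem, without any integrability discussion. *)
Definition surrogate (R : realType) (n : nat) (G : 'rV[R]_n -> R)
    (H : 'rV[R]_n -> 'rV[R]_n -> R) (m beta L K : R) (x y v : 'rV[R]_n) : R :=
  G y + H x y - m + beta^-1 * enorm (grad G y + grady H x y) ^+ 2
  - beta^-1 * dot (grad G y + grady H x y) (v + grady H x y)
  + (L + 2 * K) / (2 * beta ^+ 2) * enorm (v + grady H x y) ^+ 2.

(** * The stochastic y-step: pointwise descent and its expectation *)

Section y_step.
Context (R : realType) (n : nat) (G : 'rV[R]_n -> R)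
  (H : 'rV[R]_n -> 'rV[R]_n -> R) (L1 L3s L5s L beta K Ginf Hinf m : R).
Implicit Types x y v : 'rV[R]_n.
Hypothesis G_diff : forall y, differentiable G y.
Hypothesis Hx_diff : forall x y, differentiable (fun x' => H x' y) x.
Hypothesis Hy_diff : forall x y, differentiable (fun y' => H x y') y.
Hypothesis G_smooth : forall y1 y2,
  enorm (grad G y1 - grad G y2) <= L1 * enorm (y1 - y2).
Hypothesis H_L3 : forall x y1 y2,
  enorm (grady H x y1 - grady H x y2) <= L3s * enorm (y1 - y2).
Hypothesis H_L5 : forall x1 x2 y,
  enorm (grady H x1 y - grady H x2 y) <= L5s * enorm (x1 - x2).
Hypothesis L_ge : L3s + L1 <= L.
Hypothesis beta_gt0 : 0 < beta.
Hypothesis K_ge0 : 0 <= K.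
Hypothesis m_le : forall x y, m <= G y + H x y.

Local Notation surrogate := (surrogate G H m beta L K).

(** The descent inequalities of [G] and of [H x] are added and y' - y is replaced by its value. The
    vector [v] is arbitrary here: unbiasedness enters only on integration. *)
Lemma surrogate_ge x y v y' : y' = y - beta^-1 *: (v + grady H x y) ->
  G y' + H x y' - m + beta^-1 * enorm (grad G y + grady H x y) ^+ 2
    + K * enorm (y' - y) ^+ 2 <= surrogate x y v.
Proof.
move=> y'E; rewrite /surrogate.
have hG := descent y y' G_diff G_smooth.
have hH := @descent R n (H x) L3s y y' (Hy_diff x) (H_L3 x).
rewrite -/(grady H x y) in hH.
have yE : y' - y = - (beta^-1 *: (v + grady H x y)).
  by rewrite y'E addrAC subrr add0r.
have eyE : enorm (y' - y) ^+ 2 = (beta ^+ 2)^-1 * enorm (v + grady H x y) ^+ 2.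
  by rewrite yE enormN enormZ ?invr_ge0 ?(ltW beta_gt0)// exprMn exprVn.
have dE : dot (grad G y) (y' - y) + dot (grady H x y) (y' - y) =
    - beta^-1 * dot (grad G y + grady H x y) (v + grady H x y).
  by rewrite -dotDl yE dotNr dotZr mulNr.
have lip : (L1 + L3s) / 2 * enorm (y' - y) ^+ 2 <= L / 2 * enorm (y' - y) ^+ 2.
  apply: ler_wpM2r; first exact: sqr_ge0.
  by move: L_ge; lra.
have -> : (L + 2 * K) / (2 * beta ^+ 2) * enorm (v + grady H x y) ^+ 2 =
    L / 2 * enorm (y' - y) ^+ 2 + K * enorm (y' - y) ^+ 2.
  by rewrite eyE; field; rewrite gt_eqF.
lra.
Qed.

Lemma surrogate_ge0 x y v : 0 <= surrogate x y v.
Proof.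
apply: le_trans (surrogate_ge erefl).
apply: addr_ge0; last by rewrite mulr_ge0 ?sqr_ge0.
by apply: addr_ge0; rewrite ?subr_ge0// mulr_ge0 ?sqr_ge0// invr_ge0 ltW.
Qed.

Hypothesis L1_gt0 : 0 < L1.
Hypothesis L3s_gt0 : 0 < L3s.
Hypothesis Ginf_le : forall y, Ginf <= G y.
Hypothesis Hinf_le : forall x y, Hinf <= H x y.
Hypothesis L_gt0 : 0 < L.

Context (dS : measure_display) (S : measurableType dS) (D : probability S R)
  (g : 'rV[R]_n -> S -> 'rV[R]_n) (A A0 B0 C0 : R).
Hypothesis g_meas : measurable_fun setT
  (fun p : borelRn R n * S => g p.1 p.2 : borelRn R n).
Hypothesis g_unbiased : unbiased D G g.
Hypothesis B0_ge0 : 0 <= B0.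
Hypothesis g_ES : forall y : 'rV[R]_n,
  (\int[D]_s (enorm (g y s) ^+ 2)%:E <=
   (2 * A0 * (G y - Ginf) + B0 * enorm (grad G y) ^+ 2 + C0)%:E)%E.
Hypothesis A_ge1 : 2 * A0 + 2 * B0 * L1 <= A.
Hypothesis A_ge2 : 2 * L3s <= A.

(** On average the inner product becomes |a + b|^2 and cancels the term added in [surrogate]. The
    second moment is controlled by expected smoothness, and [grad_sqr_le] turns |a|^2 and |b|^2 into
    the gaps G - Ginf and H - Hinf; [A] dominates both resulting factors. *)
Lemma integral_surrogate_le x y :
  (\int[D]_s (surrogate x y (g y s))%:E <=
   ((1 + (L + 2 * K) * A / beta ^+ 2) * (G y + H x y - m)
    + (L + 2 * K) * (2 * A * (m - Ginf - Hinf) + 2 * C0) / (2 * beta ^+ 2))%:E)%E.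
Proof.
set a := grad G y; set b := grady H x y.
set k := (L + 2 * K) / beta ^+ 2.
have k_ge0 : 0 <= k by rewrite divr_ge0 ?sqr_ge0// addr_ge0 ?(ltW L_gt0)// mulr_ge0.
have mg i : measurable_fun setT (fun s => g y s ord0 i).
  apply: measurable_coord.
  apply: (@measurableT_comp _ _ _ _ _ _
    (fun p : borelRn R n * S => g p.1 p.2 : borelRn R n) _ (fun s =>
      (y : borelRn R n, s))) => //.
  exact: pair1_measurable.
(* These coefficients come from bounding |v + b|^2 by 2 |v|^2 + 2 |b|^2 and separating the powers of
   [v]. *)
have h := @integral_quadratic_estimator _ _ _ _ D (g y) a
  (- beta^-1 *: (a + b))
  (G y + H x y - m + beta^-1 * enorm (a + b) ^+ 2
    - beta^-1 * dot (a + b) b + k * enorm b ^+ 2) k _ mg (g_unbiased y) (g_ES y) k_ge0.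
apply: le_trans (le_trans _ h) _.
  apply: ge0_le_integral_lower => s; first by rewrite lee_fin surrogate_ge0.
  have kE : (L + 2 * K) / (2 * beta ^+ 2) = k / 2 by rewrite /k; field; rewrite gt_eqF.
  rewrite lee_fin /surrogate -/a -/b kE dotDr dotZl.
  have := ler_wpM2l k_ge0 (enormD_sqr_le (g y s) b); lra.
rewrite lee_fin.
have hb : enorm b ^+ 2 <= A * (H x y - Hinf).
  apply: le_trans (@grad_sqr_le R n (H x) L3s Hinf y L3s_gt0 (Hy_diff x) (H_L3 x)
    (Hinf_le x)) _.
  by rewrite ler_wpM2r// subr_ge0.
have ha : 2 * A0 * (G y - Ginf) + B0 * enorm a ^+ 2 <= A * (G y - Ginf).
  have h' := grad_sqr_le y L1_gt0 G_diff G_smooth Ginf_le.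
  have := ler_wpM2l B0_ge0 h'; rewrite -/a.
  have : 0 <= G y - Ginf by rewrite subr_ge0.
  by move=> /ler_wpM2r/(_ _ _ A_ge1); lra.
have dE : - beta^-1 * dot (a + b) a =
    - beta^-1 * enorm (a + b) ^+ 2 + beta^-1 * dot (a + b) b.
  by rewrite enorm_sqr [in X in _ = - beta^-1 * X + _]dotDr; ring.
rewrite dotZl dE.
have -> : (L + 2 * K) * (2 * A * (m - Ginf - Hinf) + 2 * C0) / (2 * beta ^+ 2) =
    k * (A * (m - Ginf - Hinf) + C0) by rewrite /k; field; rewrite gt_eqF.
have -> : (L + 2 * K) * A / beta ^+ 2 = k * A by rewrite /k; ring.
have := ler_wpM2l k_ge0 (lerD hb ha); lra.
Qed.

Lemma measurable_surrogate : measurable_fun setT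
  (fun q : (borelRn R n * borelRn R n) * S => surrogate q.1.1 q.1.2 (g q.1.2 q.2)).
Proof.
have lift (f : 'rV[R]_n * 'rV[R]_n -> R) : continuous f -> measurable_fun setT
    (fun q : (borelRn R n * borelRn R n) * S => f (q.1.1, q.1.2)).
  move=> cf; have mf := continuous2_borelRn_measurable cf.
  have -> : (fun q : (borelRn R n * borelRn R n) * S => f (q.1.1, q.1.2)) =
    (f : borelRn R n * borelRn R n -> R) \o fst by apply/funext => -[[]].
  exact: measurableT_comp.
have mG : measurable_fun setT (fun q : (borelRn R n * borelRn R n) * S => G q.1.2).
  apply: (lift (fun p => G p.2)) => p.
  apply: (@continuous_comp _ _ _ snd G); first exact: cvg_snd.
  exact: differentiable_continuous.
have mH := lift _ (smooth2_continuous Hx_diff Hy_diff H_L5 H_L3).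
have ma i : measurable_fun setT
    (fun q : (borelRn R n * borelRn R n) * S => grad G q.1.2 ord0 i).
  apply: (lift (fun p => grad G p.2 ord0 i)) => p.
  apply: (@continuous_comp _ _ _ snd (fun y => grad G y ord0 i)); first exact: cvg_snd.
  exact: lipschitz_coord_continuous.
have mb i := lift _ (@lipschitz2_coord_continuous _ _ _ _ _ i H_L5 H_L3).
have mv i : measurable_fun setT
    (fun q : (borelRn R n * borelRn R n) * S => g q.1.2 q.2 ord0 i).
  apply: measurable_coord.
  apply: (@measurableT_comp _ _ _ _ _ _
    (fun p : borelRn R n * S => g p.1 p.2 : borelRn R n) _
    (fun q : (borelRn R n * borelRn R n) * S => (q.1.2, q.2))) => //.
  by apply: measurable_fun_pair => //; exact: measurableT_comp.
have mp i := @measurable_vecD _ _ _ _ _ _ i ma mb.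
have mvb i := @measurable_vecD _ _ _ _ _ _ i mv mb.
rewrite /surrogate; apply: measurable_funD; first apply: measurable_funB;
  first apply: measurable_funD.
- by apply: measurable_funB => //; exact: measurable_funD.
- by apply: measurable_funM => //; exact: measurable_enorm_sqr.
- by apply: measurable_funM => //; exact: measurable_dot.
- by apply: measurable_funM => //; exact: measurable_enorm_sqr.
Qed.

End y_step.

(** By contradiction. If every [e t] exceeds X + c with X = (1 + q)^T a_0 / T, then a_(t+1) + X < (1
    + q) a_t, whence a_T + T X < (1 + q)^T a_0 = T X and a_T is negative. *)
Lemma linear_recursion_min (R : realType) (T : nat) (a e : nat -> \bar R) (q c : R) :
    (0 < T)%N -> 0 <= q -> (forall t, (t <= T)%N -> 0 <= a t)%E ->
    (forall t, 0 <= e t)%E ->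
    (forall t, (t < T)%N -> a t.+1 + e t <= (1 + q)%:E * a t + c%:E)%E ->
  exists2 t, (t < T)%N & (e t <= ((1 + q) ^+ T / T%:R)%:E * a 0%N + c%:E)%E.
Proof.
move=> T0 q0 a0 e0 rec.
have q1 : 0 < 1 + q by rewrite ltr_wpDr.
have Tr : 0 < T%:R :> R by rewrite ltr0n.
have C0 : 0 < (1 + q) ^+ T / T%:R by rewrite divr_gt0// exprn_gt0.
(* If a_0 is infinite the right-hand side is +oo and any index will do; otherwise the recursion
   keeps all the terms finite. *)
have [a0fin|] := boolP (a 0%N \is a fin_num); last first.
  rewrite ge0_fin_numE ?a0// -leNgt leye_eq => /eqP ->.
  by exists 0%N => //; rewrite gt0_muley ?lte_fin// addye// leey.
apply: contrapT => none.
have e_gt t : (t < T)%N -> (((1 + q) ^+ T / T%:R)%:E * a 0%N + c%:E < e t)%E.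
  by move=> tT; rewrite ltNge; apply/negP => h; apply: none; exists t.
have fin t : (t <= T)%N -> a t \is a fin_num.
  elim: t => [//|t IH] tT; rewrite ge0_fin_numE ?a0//.
  apply: (@le_lt_trans _ _ ((1 + q)%:E * a t + c%:E)%E).
    by apply: le_trans (rec t tT); rewrite leeDl.
  by rewrite -(fineK (IH (ltnW tT))) -EFinM -EFinD ltry.
have efin t : (t < T)%N -> e t \is a fin_num.
  move=> tT; rewrite ge0_fin_numE ?e0//.
  apply: (@le_lt_trans _ _ ((1 + q)%:E * a t + c%:E)%E).
    by apply: le_trans (rec t tT); rewrite leeDr// a0.
  by rewrite -(fineK (fin t (ltnW tT))) -EFinM -EFinD ltry.
pose X := (1 + q) ^+ T / T%:R * fine (a 0%N).
have fa0 t : (t <= T)%N -> 0 <= fine (a t) by move=> tT; rewrite fine_ge0// a0.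
have X0 : 0 <= X by rewrite mulr_ge0 ?(ltW C0) ?fa0.
have step t : (t < T)%N -> fine (a t.+1) + X < (1 + q) * fine (a t).
  move=> tT; have := rec t tT; have := e_gt t tT.
  rewrite -(fineK (efin t tT)) -(fineK (fin t (ltnW tT))) -(fineK (fin t.+1 tT)).
  rewrite -(fineK a0fin) -!EFinM -!EFinD lee_fin lte_fin -/X; lra.
have bound t : (t < T)%N ->
  fine (a t.+1) + t.+1%:R * X < (1 + q) ^+ t.+1 * fine (a 0%N).
  elim: t => [|t IH] tT; first by have := step 0%N tT; rewrite mul1r expr1.
  have h1 := step _ tT; have h2 := IH (ltnW tT).
  have h3 : (1 + q) * (fine (a t.+1) + t.+1%:R * X) < (1 + q) *
    ((1 + q) ^+ t.+1 * fine (a 0%N)).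
    by rewrite ltr_pM2l.
  have h4 : 0 <= q * (t.+1%:R * X) by apply: mulr_ge0 => //; exact: mulr_ge0.
  rewrite [(1 + q) ^+ t.+2]exprS -[t.+2%:R]natr1.
  move: h3 h4; move: (t.+1%:R) ((1 + q) ^+ t.+1) => r s; lra.
have := bound T.-1; rewrite prednK// leqnn => /(_ isT).
have -> : (1 + q) ^+ T * fine (a 0%N) = T%:R * X.
  by rewrite /X mulrA [T%:R * _]mulrC divfK ?gt_eqF.
have := fa0 T (leqnn T); lra.
Qed.

(** * Freshness of the samples and structure of the iterates *)

Section stam.
Context (R : realType) (n : nat) (F : 'rV[R]_n -> \bar R) (G : 'rV[R]_n -> R)
  (H : 'rV[R]_n -> 'rV[R]_n -> R) (d dS : measure_display)
  (Omega : measurableType d) (P : probability Omega R) (S : measurableType dS)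
  (D : probability S R) (g : 'rV[R]_n -> S -> 'rV[R]_n) (gamma beta : R)
  (T : nat) (xi : nat -> Omega -> S) (y x u z : nat -> Omega -> 'rV[R]_n).
Hypothesis run : stam_run P D F H g gamma beta T xi y x u z.

(** The pair (x_t, y_t) is measurable for the history at time t, so its events are independent of
    the fresh sample. *)
Lemma stam_integral_iterate t
    (h : (borelRn R n * borelRn R n) * S -> \bar R) : (t < T)%N ->
    measurable_fun setT h -> (forall p, 0 <= h p)%E ->
  (\int[P]_w h ((x t w, y t w), xi t w)
   = \int[P]_w \int[D]_s h ((x t w, y t w), s))%E.
Proof.
move=> tT mh h0; have [my mx _ _] := stam_measurable run t.
apply: (ge0_integral_independent (X :=
  fun w => (x t w : borelRn R n, y t w : borelRn R n))) => //.
- exact: measurable_fun_pair.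
- exact: (stam_sample run tT).
move=> E B mE mB; rewrite -(stam_law run tT mB).
apply: (stam_fresh run tT) => //.
pose gen := generated_by y t `|` generated_by x t `|` generated_by u t `|`
  generated_by z t.
have mgen (v : nat -> Omega -> 'rV[R]_n) : generated_by v t `<=` gen ->
    measurable_fun setT (v t : g_sigma_algebraType gen -> borelRn R n).
  move=> sub _ B' mB'; rewrite setTI; apply: sub_sigma_algebra; apply: sub.
  by exists t, B'.
have : measurable_fun setT (fun w : g_sigma_algebraType gen =>
    (x t w : borelRn R n, y t w : borelRn R n)).
  by apply: measurable_fun_pair; apply: mgen => A; rewrite /gen/=; tauto.
by move=> /(_ measurableT E mE); rewrite setTI.
Qed.

(** The starting condition lets t = 0 be treated like every later time: [zp] is z_(t-1), or the
    auxiliary point z_(-1) of the start. *)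
Lemma stam_prox t w : (t <= T)%N -> exists zp,
  [/\ x_update H gamma (y t w) zp (x t w), u_update F gamma (x t w) zp (u t w) &
      z t w = zp + (u t w - x t w)].
Proof.
case: t => [_|t tT]; first exact: (stam_init run w).
by exists (z t w); split;
  [exact: stam_x run _ _ tT|exact: stam_u run _ _ tT|exact: stam_z run _ _ tT].
Qed.

End stam.

Theorem theorem10 (R : realType) (n : nat)
    (F : 'rV[R]_n -> \bar R) (G : 'rV[R]_n -> R)
    (H : 'rV[R]_n -> 'rV[R]_n -> R)
    (F_proper : proper_function F) (F_lsc : lower_semicontinuous F)
    (G_diff : forall y, differentiable G y)
    (Hx_diff : forall x y, differentiable (fun x' => H x' y) x)
    (Hy_diff : forall x y, differentiable (fun y' => H x y') y)
    (H_lb : has_lbound (range (fun p : 'rV[R]_n * 'rV[R]_n => H p.1 p.2)))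
    (* (a1) *)
    (L1 : R) (L1_gt0 : 0 < L1) (G_lb : has_lbound (range G))
    (G_smooth : forall y1 y2,
       enorm (grad G y1 - grad G y2) <= L1 * enorm (y1 - y2))
    (* (a2) *)
    (L2 L3 L4 L5 : 'rV[R]_n -> R)
    (L2_gt0 : forall y, 0 < L2 y) (L3_gt0 : forall x, 0 < L3 x)
    (L4_gt0 : forall x, 0 < L4 x) (L5_gt0 : forall y, 0 < L5 y)
    (H_L2 : forall x1 x2 y,
       enorm (gradx H x1 y - gradx H x2 y) <= L2 y * enorm (x1 - x2))
    (H_L4 : forall x y1 y2,
       enorm (gradx H x y1 - gradx H x y2) <= L4 x * enorm (y1 - y2))
    (H_L3 : forall x y1 y2,
       enorm (grady H x y1 - grady H x y2) <= L3 x * enorm (y1 - y2))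
    (H_L5 : forall x1 x2 y,
       enorm (grady H x1 y - grady H x2 y) <= L5 y * enorm (x1 - x2))
    (* (a3) *)
    (L2s L3s L4s L5s L : R)
    (L2s_ge0 : 0 <= L2s) (L3s_ge0 : 0 <= L3s)
    (L4s_ge0 : 0 <= L4s) (L5s_ge0 : 0 <= L5s) (L_gt0 : 0 < L)
    (L2_le : forall y, L2 y <= L2s) (L3_le : forall x, L3 x <= L3s)
    (L4_le : forall x, L4 x <= L4s) (L5_le : forall y, L5 y <= L5s)
    (L_ge : L3s + L1 <= L)
    (l : R)
    (H_wconvex : forall y,
       convex_function setT (fun x => H x y + l / 2 * enorm x ^+ 2))
    (* stochastic gradient *)
    (dS : measure_display) (S : measurableType dS) (D : probability S R)
    (g : 'rV[R]_n -> S -> 'rV[R]_n)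
    (g_meas : measurable_fun setT
       (fun p : borelRn R n * S => g p.1 p.2 : borelRn R n))
    (g_unbiased : unbiased D G g)
    (A0 B0 C0 : R) (A0_ge0 : 0 <= A0) (B0_ge0 : 0 <= B0) (C0_ge0 : 0 <= C0)
    (g_ES : expected_smoothness D G g A0 B0 C0)
    (* STAM *)
    (d : measure_display) (Omega : measurableType d)
    (P : probability Omega R)
    (gamma beta : R) (gamma_gt0 : 0 < gamma) (beta_gt0 : 0 < beta)
    (T : nat) (T_gt0 : (0 < T)%N)
    (xi : nat -> Omega -> S) (y x u z : nat -> Omega -> 'rV[R]_n)
    (run : stam_run P D F H g gamma beta T xi y x u z) :
  let Ginf := inf (range G) in
  let Hinf := inf (range (fun p : 'rV[R]_n * 'rV[R]_n => H p.1 p.2)) in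
  let GHinf :=
    inf (range (fun p : 'rV[R]_n * 'rV[R]_n => G p.2 + H p.1 p.2)) in
  let A : R := Num.max (2 * A0 + 2 * B0 * L1) (2 * L3s) in
  let C : R := 2 * A * (GHinf - Ginf - Hinf) + 2 * C0 in
  let delta0 :=
    (\int[P]_w (G (y 0%N w) + H (x 0%N w) (y 0%N w) - GHinf)%:E)%E in
  let Mt t w := merit F gamma (x t w) (u t w) (z t w) in
  let M0' := (\int[P]_w (Mt 0%N w - ereal_inf (range (Mt ^~ w))))%E in
  let K1 := (1 - (10 * (l + L2s) + 4) * gamma - 5 * L2s ^+ 2 * gamma ^+ 2)
            / (4 * gamma) in
  let K2 := 5 * (1 + gamma * L2s) ^+ 2 / (4 * gamma ^+ 2) in
  let K3 := L4s * (1 + 5 * gamma * L4s) + 5 * K1 * L4s ^+ 2 / K2 in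
  let M := 2 * K3 in
  0 < K1 ->
  (L2s ^+ 2 + L5s ^+ 2) * gamma ^+ 2 <= 1 ->
  2 <= beta * K1 / K2 ->
  (\big[Order.min/+oo]_(t < T)
      (\int[P]_w (enorm (grad G (y t w) + grady H (u t w) (y t w)) ^+ 2)%:E
       + \int[P]_w (dist0 [set (gradx H (u t w) (y t w) + v)%R
                          | v in limiting_subdiff F (u t w)] ^+ 2))
   <= (2 * ((1 + (L + M) * A / beta ^+ 2) ^+ T / T%:R) * beta)%:E
        * (delta0 + M0')
      + ((L + M) * C / beta)%:E)%E.
Proof.
move=> Ginf Hinf GHinf A C delta0 Mt M0' K1 K2 K3 M K1_gt0 gammaL_le betaK_ge.
have L2s_gt0 : 0 < L2s := lt_le_trans (L2_gt0 0) (L2_le 0).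
have L3s_gt0 : 0 < L3s := lt_le_trans (L3_gt0 0) (L3_le 0).
have H_L2s x1 x2 y' : enorm (gradx H x1 y' - gradx H x2 y') <= L2s * enorm (x1 - x2).
  by apply: le_trans (H_L2 _ _ _) _; rewrite ler_wpM2r// enorm_ge0.
have H_L3s x' y1 y2 : enorm (grady H x' y1 - grady H x' y2) <= L3s * enorm (y1 - y2).
  by apply: le_trans (H_L3 _ _ _) _; rewrite ler_wpM2r// enorm_ge0.
have H_L4s x' y1 y2 : enorm (gradx H x' y1 - gradx H x' y2) <= L4s * enorm (y1 - y2).
  by apply: le_trans (H_L4 _ _ _) _; rewrite ler_wpM2r// enorm_ge0.
have H_L5s x1 x2 y' : enorm (grady H x1 y' - grady H x2 y') <= L5s * enorm (x1 - x2).
  by apply: le_trans (H_L5 _ _ _) _; rewrite ler_wpM2r// enorm_ge0.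
have Ginf_le y' : Ginf <= G y' by apply: ge_inf => //; exists y'.
have Hinf_le x' y' : Hinf <= H x' y' by apply: ge_inf => //; exists (x', y').
have GHinf_le x' y' : GHinf <= G y' + H x' y'.
  apply: ge_inf; last by exists (x', y').
  by exists (Ginf + Hinf) => _ [p _ <-]; exact: lerD.
have gammaL2_gt0 : 0 < 1 + gamma * L2s by rewrite ltr_wpDr// mulr_ge0// ltW.
have K2_gt0 : 0 < K2.
  by apply: divr_gt0; apply: mulr_gt0 => //; exact: exprn_gt0.
have K3_ge0 : 0 <= K3.
  apply: addr_ge0.
    by rewrite mulr_ge0// addr_ge0// !mulr_ge0// ltW.
  by apply: divr_ge0; [apply: mulr_ge0; [apply: mulr_ge0 => //;
    exact: ltW|exact: sqr_ge0]|exact: ltW].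
have A_ge1 : 2 * A0 + 2 * B0 * L1 <= A by rewrite /A le_max lexx.
have A_ge2 : 2 * L3s <= A by rewrite /A le_max lexx orbT.
have A_ge0 : 0 <= A by apply: le_trans A_ge2; rewrite mulr_ge0.
pose c1 := K1 / (K2 * gamma ^+ 2).
have c1_gt0 : 0 < c1 by apply: divr_gt0 => //; apply: mulr_gt0 => //; exact: exprn_gt0.
pose q := (L + M) * A / beta ^+ 2.
have q_ge0 : 0 <= q.
  apply: divr_ge0; last exact: sqr_ge0.
  by apply: mulr_ge0 => //; apply: addr_ge0; [exact: ltW|exact: mulr_ge0].
(* The final multiplication by 2 beta turns [c] into the additive constant of the theorem. *)
pose c := (L + M) * C / (2 * beta ^+ 2).
pose Phi t w := G (y t w) + H (x t w) (y t w) - GHinf.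
pose N t w := (Mt t w - ereal_inf (range (Mt ^~ w)))%E.
pose p t w := grad G (y t w) + grady H (x t w) (y t w).
pose e t w := beta^-1 * enorm (p t w) ^+ 2 + c1 * enorm (u t w - x t w) ^+ 2.
have Phi_ge0 t w : 0 <= Phi t w by rewrite subr_ge0.
have e_ge0 t w : 0 <= e t w.
  by apply: addr_ge0; rewrite mulr_ge0 ?sqr_ge0 ?invr_ge0 ?(ltW beta_gt0) ?(ltW c1_gt0).
have FNy v : F v != -oo%E by have [] := F_proper.
have Mt_Ny t w : Mt t w != -oo%E.
  by rewrite /Mt /merit; move: (FNy (u t w)); case: (F (u t w)).
have prox : forall t w, (t <= T)%N -> exists zp,
    [/\ zp = x t w + gamma *: gradx H (x t w) (y t w),
        u_update F gamma (x t w) zp (u t w) & z t w = zp + (u t w - x t w)].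
  move=> t w tT; have [zp [xP uP zE]] := stam_prox run w tT.
  exists zp; split=> //.
  exact: (x_updateE gamma_gt0 L2s_gt0 (Hx_diff^~ (y t w)) (fun a b => H_L2s a b
    (y t w)) xP).
have Fu_fin t w : (t <= T)%N -> F (u t w) \is a fin_num.
  by move=> tT; have [zp [_ uP _]] := prox t w tT; exact: u_update_fin uP.
have Mt_fin t w : (t <= T)%N -> Mt t w \is a fin_num.
  by move=> tT; rewrite /Mt /merit -(fineK (Fu_fin t w tT)).
(* The infimum lies below the finite value at time 0, so it is not +oo and the difference +oo - +oo,
   which is -oo by convention, never occurs. The infimum may be -oo, in which case [N t w] is
   +oo. *)
have N_ge0 t w : (0 <= N t w)%E.
  have inf_le s : (ereal_inf (range (Mt ^~ w)) <= Mt s w)%E.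
    by apply: ereal_inf_lbound; exists s.
  have := inf_le 0%N; rewrite /N -(fineK (Mt_fin 0%N w (leq0n _))).
  move: (inf_le t) (Mt_Ny t w); case: (ereal_inf _) => [s| |];
    case: (Mt t w) => [r| |] //= h _ _;
    by [exact: leey|rewrite -EFinD lee_fin subr_ge0 -lee_fin].
have one_step t w : (t < T)%N ->
    ((Phi t.+1 w)%:E + N t.+1 w + (e t w)%:E <=
     (surrogate G H GHinf beta L K3 (x t w) (y t w) (g (y t w) (xi t w)))%:E + N t w)%E.
  move=> tT; have [zp [zpE uP zE]] := prox t w (ltnW tT).
  have yE := y_updateE beta_gt0 (stam_y run w tT).
  have h1 := surrogate_ge K3 GHinf G_diff Hy_diff G_smooth H_L3s L_ge beta_gt0 yE.
  have z1 := x_updateE gamma_gt0 L2s_gt0 (Hx_diff^~ (y t.+1 w))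
    (fun a b => H_L2s a b (y t.+1 w)) (stam_x run w tT).
  have z0 : z t w = x t w + gamma *: gradx H (x t w) (y t w) + (u t w - x t w)
    by rewrite zE zpE.
  have h2 := merit_descent gamma_gt0 L2s_ge0 Hx_diff H_L2s H_L4s H_wconvex F_proper
    K1_gt0 L4s_ge0
     z0 (Fu_fin t w (ltnW tT)) z1 (stam_u run w tT) (stam_z run w tT).
  rewrite /N -(fineK (Mt_fin t w (ltnW tT))) -(fineK (Mt_fin t.+1 w tT)).
  (* The infimum of the merit values, possibly -oo, is the same on both sides and is removed as a
     common summand; the rest is real. *)
  rewrite addeAC !addeA -!EFinD leeD2r// lee_fin.
  move: h1 h2; rewrite -/K1 -/K2 -/K3 -/c1 /Phi /e -/(p t w) -/(Mt t w) -/(Mt t.+1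
    w); lra.
have residual t w : (t < T)%N ->
    enorm (grad G (y t w) + grady H (u t w) (y t w)) ^+ 2
    + ((1 + gamma * L2s) / gamma) ^+ 2 * enorm (u t w - x t w) ^+ 2 <= 2 * beta * e t w.
  move=> tT.
  have -> : grad G (y t w) + grady H (u t w) (y t w) =
      p t w + (grady H (u t w) (y t w) - grady H (x t w) (y t w)).
    by apply/rowP => i; rewrite !mxE; ring.
  have h1 := enormD_sqr_le (p t w) (grady H (u t w) (y t w) - grady H (x t w) (y t w)).
  have h2 := ler_sqr_ge0 (enorm_ge0 _) (H_L5s (u t w) (x t w) (y t w)).
  have h3 : (2 * L5s ^+ 2 + ((1 + gamma * L2s) / gamma) ^+ 2) * enorm
    (u t w - x t w) ^+ 2
      <= 2 * beta * c1 * enorm (u t w - x t w) ^+ 2.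
    (* Multiplied by gamma^2, the left coefficient is at most 2 (L2s^2 + L5s^2) gamma^2 + 2 <= 4 by
       (1 + r)^2 <= 2 + 2 r^2 and [gammaL_le], and the right one is 2 beta K1 / K2 >= 4 by
       [betaK_ge]. *)
    apply: ler_wpM2r; first exact: sqr_ge0.
    have -> : 2 * L5s ^+ 2 + ((1 + gamma * L2s) / gamma) ^+ 2 =
      (2 * L5s ^+ 2 * gamma ^+ 2 + (1 + gamma * L2s) ^+ 2) / gamma ^+ 2.
      by field; rewrite gt_eqF.
    have -> : 2 * beta * c1 = 2 * (beta * K1 / K2) / gamma ^+ 2.
      by rewrite /c1; field; rewrite (lt0r_neq0 K2_gt0) gt_eqF.
    apply: ler_wpM2r; first by rewrite invr_ge0 sqr_ge0.
    have := sqr_ge0 (1 - gamma * L2s); lra.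
  have -> : 2 * beta * e t w =
    2 * enorm (p t w) ^+ 2 + 2 * beta * c1 * enorm (u t w - x t w) ^+ 2.
    by rewrite /e; field; rewrite gt_eqF.
  lra.

(* Measurability of the quantities to be integrated *)
have m_coord t : [/\ forall i, measurable_fun setT (fun w => y t w ord0 i),
    forall i, measurable_fun setT (fun w => x t w ord0 i),
    forall i, measurable_fun setT (fun w => u t w ord0 i) &
    forall i, measurable_fun setT (fun w => z t w ord0 i)].
  by have [my mx mu mz] := stam_measurable run t; split=> i; exact: measurable_coord.
have m_comp2 (v v' : Omega -> 'rV[R]_n) (f : 'rV[R]_n * 'rV[R]_n -> R) : continuous f ->
    measurable_fun setT (v : Omega -> borelRn R n) ->
    measurable_fun setT (v' : Omega -> borelRn R n) ->
    measurable_fun setT (fun w => f (v w, v' w)).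
  move=> cf mv mv'; apply: (@measurableT_comp _ _ _ _ _ _
    (f : borelRn R n * borelRn R n -> R) _
    (fun w => (v w : borelRn R n, v' w : borelRn R n)));
      last exact: measurable_fun_pair.
  exact: continuous2_borelRn_measurable.
have m_gradG t i : measurable_fun setT (fun w => grad G (y t w) ord0 i).
  have [my _ _ _] := stam_measurable run t.
  apply: (@measurableT_comp _ _ _ _ _ _ (fun v : borelRn R n => grad G v ord0 i) _
     (y t : Omega -> borelRn R n)) => //.
  apply: continuous_borelRn_measurable; exact: lipschitz_coord_continuous.
have c_grady i := @lipschitz2_coord_continuous _ _ _ _ _ i H_L5s H_L3s.
have m_Phi t : measurable_fun setT (Phi t).
  have [my mx _ _] := stam_measurable run t.
  apply: measurable_funB => //; apply: measurable_funD.
    apply: (@measurableT_comp _ _ _ _ _ _ (G : borelRn R n -> R) _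
     (y t : Omega -> borelRn R n)) => //.
    apply: continuous_borelRn_measurable => v; exact: differentiable_continuous.
  exact: (m_comp2 _ _ _ (smooth2_continuous Hx_diff Hy_diff H_L5s H_L3s) mx my).
have m_p t i : measurable_fun setT (fun w => p t w ord0 i).
  have [my mx _ _] := stam_measurable run t.
  apply: measurable_vecD => // j; exact: (m_comp2 _ _ _ (c_grady j) mx my).
have m_ux t : measurable_fun setT (fun w => enorm (u t w - x t w) ^+ 2).
  by have [_ mx mu _] := m_coord t; apply: measurable_enorm_sqr => i;
    exact: measurable_vecB.
have m_e t : measurable_fun setT (e t).
  by apply: measurable_funD; apply: measurable_funM => //; exact: measurable_enorm_sqr.
have m_Mt t : measurable_fun setT (Mt t).
  have [my mx mu mz] := m_coord t; have [_ _ mu' _] := stam_measurable run t.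
  apply: emeasurable_funD.
    apply: (@measurableT_comp _ _ _ _ _ _ (F : borelRn R n -> \bar R) _
     (u t : Omega -> borelRn R n)) => //.
    exact: lower_semicontinuous_borelRn_measurable.
  apply/measurable_EFinP; apply: measurable_funB; last exact: measurable_funM.
  apply: measurable_funB; apply: measurable_funM => //;
    apply: measurable_enorm_sqr => i.
    apply: measurable_vecB => // j; apply: measurable_vecB => // k.
    by under eq_fun do rewrite mxE; exact: measurable_funM.
  exact: measurable_vecB.
have m_N t : measurable_fun setT (N t).
  apply: emeasurable_funB => //.
  have -> : (fun w => ereal_inf (range (Mt ^~ w))) = (fun w => einfs (Mt ^~ w) 0%N).
    apply/funext => w; rewrite /einfs /=; congr ereal_inf.
    by apply/seteqP; split=> _ [k _ <-]; exists k.
  exact: measurable_fun_einfs.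

(* The recursion in expectation *)
pose a t := (\int[P]_w ((Phi t w)%:E + N t w))%E.
have a_ge0 t : (0 <= a t)%E.
  by apply: integral_ge0 => w _; rewrite adde_ge0// lee_fin.
have Ee_ge0 t : (0 <= \int[P]_w (e t w)%:E)%E.
  by apply: integral_ge0 => w _; rewrite lee_fin.
have C_ge0 : 0 <= C.
  apply: addr_ge0; rewrite mulr_ge0// ?mulr_ge0// -addrA -opprD subr_ge0.
  apply: lb_le_inf; first by exists (G 0 + H 0 0); exists (0, 0).
  by move=> _ [v _ <-]; exact: lerD.
have c_ge0 : 0 <= c.
  apply: divr_ge0; last by rewrite mulr_ge0 ?sqr_ge0.
  by apply: mulr_ge0 => //; apply: addr_ge0; [exact: ltW|exact: mulr_ge0].
have q1_ge0 : 0 <= 1 + q by rewrite addr_ge0.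
have aD t : a t = (\int[P]_w (Phi t w)%:E + \int[P]_w N t w)%E.
  rewrite /a ge0_integralD//; first by move=> w _; rewrite lee_fin.
  exact/measurable_EFinP.
have rec t : (t < T)%N ->
    (a t.+1 + \int[P]_w (e t w)%:E <= (1 + q)%:E * a t + c%:E)%E.
  move=> tT; have [my mx _ _] := stam_measurable run t.
  have m_sur := measurable_surrogate L beta K3 GHinf G_diff Hx_diff Hy_diff G_smooth
    H_L3s H_L5s g_meas.
  have sur_ge0 x' y' v : 0 <= surrogate G H GHinf beta L K3 x' y' v.
    exact: (surrogate_ge0 G_diff Hy_diff G_smooth H_L3s L_ge beta_gt0 K3_ge0 GHinf_le).
  pose h (r : (borelRn R n * borelRn R n) * S) :=
    (surrogate G H GHinf beta L K3 r.1.1 r.1.2 (g r.1.2 r.2))%:E.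
  have m_h : measurable_fun setT h by exact/measurable_EFinP.
  have m_run : measurable_fun setT (fun w => h ((x t w, y t w), xi t w)).
    apply: (@measurableT_comp _ _ _ _ _ _ h _
      (fun w => ((x t w : borelRn R n, y t w : borelRn R n), xi t w))) => //.
    apply: measurable_fun_pair; first exact: measurable_fun_pair.
    exact: (stam_sample run tT).
  have h_ge0 r : (0 <= h r)%E by rewrite lee_fin.
  rewrite {1}/a -ge0_integralD//; last 4 first.
  - by move=> w _; rewrite adde_ge0// lee_fin.
  - by apply: emeasurable_funD => //; exact/measurable_EFinP.
  - by move=> w _; rewrite lee_fin.
  - exact/measurable_EFinP.
  apply: (@le_trans _ _ (\int[P]_w (h ((x t w, y t w), xi t w) + N t w))%E).
    apply: ge0_le_integral_lower => w; last exact: one_step.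
    by apply: adde_ge0; [apply: adde_ge0|]; rewrite ?lee_fin.
  (* Averaging over the fresh sample first makes [integral_surrogate_le] applicable at each fixed
     (x_t, y_t). *)
  rewrite ge0_integralD// (stam_integral_iterate run tT m_h h_ge0).
  apply: (@le_trans _ _ (\int[P]_w ((1 + q)%:E *
    (Phi t w)%:E + c%:E) + \int[P]_w N t w)%E).
    apply: leeD2r; apply: ge0_le_integral_lower => w;
      first by apply: integral_ge0 => s _.
    exact: (integral_surrogate_le G_diff Hy_diff G_smooth H_L3s L_ge beta_gt0 K3_ge0
      GHinf_le
      L1_gt0 L3s_gt0 Ginf_le Hinf_le L_gt0 g_meas g_unbiased B0_ge0 g_ES A_ge1 A_ge2).
  rewrite ge0_integralD//; last 2 first.
  - by move=> w _; rewrite mule_ge0// lee_fin.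
  - by apply: measurable_funeM; exact/measurable_EFinP.
  rewrite ge0_integralZl//; last 2 first.
  - exact/measurable_EFinP.
  - by move=> w _; rewrite lee_fin.
  have -> : (\int[P]_w c%:E = c%:E)%E.
    transitivity (c%:E * P setT)%E; first exact: (integral_cst P measurableT c%:E).
    by transitivity (c%:E * 1)%E; [congr (_ * _)%E;
      exact: probability_setT|exact: mule1].
  have EPhi_ge0 : (0 <= \int[P]_w (Phi t w)%:E)%E.
    by apply: integral_ge0 => w _; rewrite lee_fin.
  have EN_ge0 : (0 <= \int[P]_w N t w)%E by apply: integral_ge0 => w _.
  (* The y-step produces the factor 1 + q on the [Phi] part alone; the [N] part is enlarged by it as
     well, so that the recursion closes on [a]. *)
  rewrite aD (ge0_muleDr _ EPhi_ge0 EN_ge0).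
  rewrite addeAC; apply: leeD2r; apply: leeD2l.
  by apply: lee_pemull; rewrite // lee_fin lerDl.
have [t tT et] := linear_recursion_min T_gt0 q_ge0 (fun t _ => a_ge0 t) Ee_ge0 rec.

(* From the recursion to the stationarity measure *)
have aE : (delta0 + M0' = a 0%N)%E by rewrite aD.
rewrite aE.
(* The minimum is bounded by its term at the index [t] found by the recursion. *)
apply: (@bigmin_inf _ _ _ _ (Ordinal tT)) => //=.
pose k := ((1 + gamma * L2s) / gamma) ^+ 2.
pose r w := enorm (grad G (y t w) + grady H (u t w) (y t w)) ^+ 2.
have k_ge0 : 0 <= k by exact: sqr_ge0.
have m_r : measurable_fun setT r.
  have [my _ mu _] := stam_measurable run t.
  apply: measurable_enorm_sqr => i; apply: measurable_vecD => // j.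
  exact: (m_comp2 _ _ _ (c_grady j) mu my).
apply: (@le_trans _ _ (\int[P]_w (r w)%:E + \int[P]_w (k * enorm
  (u t w - x t w) ^+ 2)%:E)%E).
  apply: leeD2l; apply: ge0_le_integral_lower => w.
    by apply: mule_ge0; apply: le_ereal_inf_tmp => _ [s _ <-];
      rewrite lee_fin enorm_ge0.
  have [zp [zpE uP _]] := prox t w (ltnW tT).
  exact: (dist0_subdiff_le gamma_gt0 H_L2s F_proper zpE uP).
rewrite -ge0_integralD//; last 4 first.
- by move=> w _; rewrite lee_fin sqr_ge0.
- exact/measurable_EFinP.
- by move=> w _; rewrite lee_fin mulr_ge0 ?sqr_ge0.
- by apply/measurable_EFinP; exact: measurable_funM.
have b2_ge0 : 0 <= 2 * beta by rewrite mulr_ge0// ltW.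
apply: (@le_trans _ _ (\int[P]_w ((2 * beta)%:E * (e t w)%:E))%E).
  apply: ge0_le_integral_lower => w.
    by apply: adde_ge0; rewrite lee_fin ?sqr_ge0// mulr_ge0 ?sqr_ge0.
  by rewrite -EFinM -EFinD lee_fin; exact: residual.
rewrite ge0_integralZl//; last 2 first.
- exact/measurable_EFinP.
- by move=> w _; rewrite lee_fin.
apply: le_trans (lee_wpmul2l _ et) _; first by rewrite lee_fin.
rewrite muleDr ?fin_num_adde_defl// muleA -!EFinM.
apply: leeD.
  by rewrite mulrAC.
rewrite lee_fin le_eqVlt; apply/orP; left; apply/eqP.
by rewrite /c; field; rewrite gt_eqF.
Qed.
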